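(* For pairs of communicating SR-machines the following problems are algorithmically undecidable: (a) given such a pair in which neither machine has a send cycle, is it deadlock-free? (b) given such a deadlock-free pair in which neither machine has a send cycle, does it have the bounded channel property? (c) given an affine such pair, is it deadlock-free? (d) given an affine such pair, does it have the bounded channel property?
   Context: A pair of communicating SR-machines is a CFSM protocol with communication graph having nodes $\{0,1\}$ and two edges $\alpha$ (from $0$ to $1$) and $\beta$ (from $1$ to $0$), disjoint finite message alphabets $M_\alpha,M_\beta$, and two finite state machines $F_j=(K_j,\Sigma_j,T_j,h_j)$, $j=0,1$, with $\Sigma_0=\{-b:b\in M_\alpha\}\cup\{+b:b\in M_\beta\}$, $\Sigma_1=\{-b:b\in M_\beta\}\cup\{+b:b\in M_\alpha\}$, $K_j$ finite, $h_j\in K_j$ initial, $T_j\subseteq K_j\times\Sigma_j\times K_j$ (transitions $p\xrightarrow{e}q$; $+b$ = receive, $-b$ = send; $p\xrightarrow{w}q$ means a directed path labelled $w$). A send state has no outgoing $+b$ transition, a receive state no outgoing $-b$ transition. $F_j$ is an SR-machine if every state is a send or a receive state, its transition diagram is strongly connected, and it is deterministic ($p\xrightarrow{e}q_1$, $p\xrightarrow{e}q_2$ imply $q_1=q_2$). Global states are $((p_0,p_1),(x_\alpha,x_\beta))$; initially $((h_0,h_1),(\lambda,\lambda))$. A step is a send (a machine performs $p\xrightarrow{-b}q$ and $b$ is appended to its output channel: $\alpha$ for $F_0$, $\beta$ for $F_1$) or a receive (a machine performs $p\xrightarrow{+b}q$ and $b$ is removed from the front of its input channel, which must begin with $b$);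 the other machine is unchanged. A global state is deadlocked if both components are receive states and both channels are empty; deadlock-free means no reachable deadlocked global state. Bounded channel property: $|x_\alpha|+|x_\beta|$ bounded over all reachable global states. $\pi_\alpha(w)$ (resp. $\pi_\beta(w)$) is the string of $M_\alpha$- (resp. $M_\beta$-) symbols in $w$, in order, signs removed; $\mathbf Z_j=\{(\pi_\alpha(w),\pi_\beta(w)): h_j\xrightarrow{w}h_j\}$; the pair is affine if $\mathbf Z_0=\mathbf Z_1$. A send cycle of $F_j$ is a directed cycle in its transition diagram all of whose labels are of the form $-b$. *)

(* Defs.v *)
From mathcomp Require Import all_boot.
Set Implicit Arguments.
Unset Strict Implicit.
Unset Printing Implicit Defensive.

(* 1. A concrete model of computation: register (Minsky) machines.    *)
(*    "Algorithmically decidable" = decidable by such a machine acting *)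
(*    on the natural-number code (pickle) of the instance.             *)

Inductive instr : Type :=
| INC of nat & nat          (* INC r j : reg r += 1; goto j *)
| DEC of nat & nat & nat.   (* DEC r j k : if reg r = 0 goto k else (reg r -= 1; goto j) *)

Definition program := seq instr.
Definition regs := nat -> nat.
Definition upd (f : regs) (r v : nat) : regs := fun i => if i == r then v else f i.

Definition rm_step (P : program) (c : nat * regs) : option (nat * regs) :=
  let: (pc, f) := c in
  if pc < size P then
    match nth (INC 0 0) P pc with
    | INC r j => Some (j, upd f r (f r).+1)
    | DEC r j k => if f r == 0 then Some (k, f) else Some (j, upd f r (f r).-1)
    end
  else None.

Fixpoint rm_run (P : program) (t : nat) (c : nat * regs) : nat * regs :=
  match t with
  | 0 => c
  | t'.+1 => match rm_step P c with Some c' => rm_run P t' c' | None => c end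
  end.

Definition rm_halts_with (P : program) (n m : nat) : Prop :=
  exists t, let c := rm_run P t (0, upd (fun _ => 0) 0 n) in
            rm_step P c = None /\ c.2 0 = m.

(* Promise problem (D = promise, Q = question) on a countable type of
   instances is algorithmically decidable. *)
Definition rm_decidable (T : countType) (D Q : T -> Prop) : Prop :=
  exists P : program, forall x, D x ->
    exists m, rm_halts_with P (pickle x) m /\ (Q x <-> m = 1).

Definition undecidable (T : countType) (D Q : T -> Prop) : Prop :=
  ~ rm_decidable D Q.

(* A label (s, b): s = true means the send event -b, s = false the
   receive event +b; b is a message (a natural number). *)
Definition label := (bool * nat)%type.
Definition transition := (nat * label * nat)%type.

(* A machine (K, h, T): states are 0, ..., K-1, initial state h,
   transition list T of triples (p, e, q) meaning p --e--> q. *)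
Definition machine := (nat * nat * seq transition)%type.
Definition m_nstates (F : machine) : nat := F.1.1.
Definition m_init (F : machine) : nat := F.1.2.
Definition m_trans (F : machine) : seq transition := F.2.

(* A protocol (ka, kb, F0, F1): M_alpha = {0..ka-1} (messages on channel
   alpha : 0 -> 1), M_beta = {0..kb-1} (messages on channel beta : 1 -> 0).
   The two alphabets are disjoint as they label different channels. *)
Definition protocol := (nat * nat * machine * machine)%type.
Definition p_ka (P : protocol) : nat := P.1.1.1.
Definition p_kb (P : protocol) : nat := P.1.1.2.
Definition p_F0 (P : protocol) : machine := P.1.2.
Definition p_F1 (P : protocol) : machine := P.2.
Definition p_mach (P : protocol) (j : bool) : machine :=
  if j then p_F1 P else p_F0 P.

(* Sigma_j : F_0 sends alpha-messages and receives beta-messages;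
   F_1 sends beta-messages and receives alpha-messages. *)
Definition in_alphabet (P : protocol) (j : bool) (e : label) : bool :=
  let: (s, b) := e in
  (* the message is an alpha message iff (s = send) xor (j = F_1) *)
  if s (+) j then b < p_ka P else b < p_kb P.

Definition is_alpha (j : bool) (e : label) : bool := e.1 (+) j.

Inductive mpath (F : machine) : nat -> seq label -> nat -> Prop :=
| mpath_nil p : mpath F p [::] p
| mpath_cons p e q w r :
    (p, e, q) \in m_trans F -> mpath F q w r -> mpath F p (e :: w) r.

Definition send_state (F : machine) (p : nat) : Prop :=
  forall e q, (p, e, q) \in m_trans F -> e.1 = true.
Definition recv_state (F : machine) (p : nat) : Prop :=
  forall e q, (p, e, q) \in m_trans F -> e.1 = false.

Definition wf_machine (P : protocol) (j : bool) : Prop :=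
  let F := p_mach P j in
  m_init F < m_nstates F /\
  forall p e q, (p, e, q) \in m_trans F ->
    [/\ p < m_nstates F, q < m_nstates F & in_alphabet P j e].

Definition SR_machine (P : protocol) (j : bool) : Prop :=
  let F := p_mach P j in
  [/\ wf_machine P j,
      (forall p, p < m_nstates F -> send_state F p \/ recv_state F p),
      (forall p q, p < m_nstates F -> q < m_nstates F -> exists w, mpath F p w q)
    & (forall p e q1 q2, (p, e, q1) \in m_trans F -> (p, e, q2) \in m_trans F ->
         q1 = q2)].

Definition SR_pair (P : protocol) : Prop := SR_machine P false /\ SR_machine P true.

Definition has_send_cycle (F : machine) : Prop :=
  exists p w, w != [::] /\ all (fun e : label => e.1) w /\ mpath F p w p.

(* global states ((p0, p1), (x_alpha, x_beta)) *)
Definition gstate := ((nat * nat) * (seq nat * seq nat))%type.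
Definition ginit (P : protocol) : gstate :=
  ((m_init (p_F0 P), m_init (p_F1 P)), ([::], [::])).

Inductive gstep (P : protocol) : gstate -> gstate -> Prop :=
| send0 p0 q0 p1 b xa xb : (p0, (true, b), q0) \in m_trans (p_F0 P) ->
    gstep P ((p0, p1), (xa, xb)) ((q0, p1), (rcons xa b, xb))
| send1 p0 p1 q1 b xa xb : (p1, (true, b), q1) \in m_trans (p_F1 P) ->
    gstep P ((p0, p1), (xa, xb)) ((p0, q1), (xa, rcons xb b))
| recv0 p0 q0 p1 b xa xb : (p0, (false, b), q0) \in m_trans (p_F0 P) ->
    gstep P ((p0, p1), (xa, b :: xb)) ((q0, p1), (xa, xb))
| recv1 p0 p1 q1 b xa xb : (p1, (false, b), q1) \in m_trans (p_F1 P) ->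
    gstep P ((p0, p1), (b :: xa, xb)) ((p0, q1), (xa, xb)).

Inductive reachable (P : protocol) : gstate -> Prop :=
| reach_init : reachable P (ginit P)
| reach_step g g' : reachable P g -> gstep P g g' -> reachable P g'.

Definition deadlocked (P : protocol) (g : gstate) : Prop :=
  [/\ recv_state (p_F0 P) g.1.1, recv_state (p_F1 P) g.1.2,
      g.2.1 = [::] & g.2.2 = [::]].

Definition deadlock_free (P : protocol) : Prop :=
  forall g, reachable P g -> ~ deadlocked P g.

Definition bounded_channel (P : protocol) : Prop :=
  exists B, forall g, reachable P g -> size g.2.1 + size g.2.2 <= B.

Definition pi_alpha (j : bool) (w : seq label) : seq nat :=
  [seq e.2 | e <- w & is_alpha j e].
Definition pi_beta (j : bool) (w : seq label) : seq nat :=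
  [seq e.2 | e <- w & ~~ is_alpha j e].

Definition Zset (P : protocol) (j : bool) (u : seq nat * seq nat) : Prop :=
  let F := p_mach P j in
  exists w, mpath F (m_init F) w (m_init F) /\ u = (pi_alpha j w, pi_beta j w).

Definition affine (P : protocol) : Prop :=
  forall u, Zset P false u <-> Zset P true u.

Definition no_send_cycles (P : protocol) : Prop :=
  ~ has_send_cycle (p_F0 P) /\ ~ has_send_cycle (p_F1 P).

(* Main.v *)
Require Import Defs.
From mathcomp Require Import all_boot.
From mathcomp Require Import zify boolp.
Set Implicit Arguments.
Unset Strict Implicit.
Unset Printing Implicit Defensive.

(** A register machine is simulated by a single queue: machine 0 receives a letter
    and sends back at most two letters, machine 1 echoes, and the contents of the
    two channels together form the queue.  If the register machine halts, machine 0
    swallows the queue and the pair deadlocks; if it does not, the queue length is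
    the sum of the registers plus one.

    No universal machine is needed.  The input [k] of the simulated program is the
    length of a chain of sends in machine 0, so the code of the protocol is an
    explicit primitive recursive function of [k] and finitely many numbers that
    depend only on the program; choosing [k] to be the code of these numbers, the
    program can compute the code of its own protocol from its input, run the
    hypothetical decider on it, and do the opposite of the answer.

    For (a) and (b) the machines are made strongly connected by transitions that
    receive a message which is never sent.  For (c) and (d) they are completed so that
    a home-to-home path reads exactly the pairs [(u1 E ... un E, v1 E ... vn E)] in
    which every [ui] and [vi] contains the stray letter [1], which gives affinity.
    A machine which has sent a wrong letter strays: for (c) it then sends garbage
    and so cannot take part in a deadlock; for (d) it first waits for the end marker
    [E] of its partner, which never comes because [E] is only sent after one has
    been received. *)

(** * Relocatable register-machine code *)

Definition shift (a : nat) (i : instr) : instr :=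
  match i with
  | INC r j => INC r (j + a)
  | DEC r j k => DEC r (j + a) (k + a)
  end.

Definition code_at (P : program) (a : nat) (C : program) : Prop :=
  a + size C <= size P /\
  forall i, i < size C -> nth (INC 0 0) P (a + i) = shift a (nth (INC 0 0) C i).

Definition steps (P : program) (c c' : nat * regs) : Prop :=
  exists t, rm_run P t c = c'.

(* [C] is entered at its first instruction and left at address [size C]. *)
Definition runs (C : program) (s s' : regs) : Prop :=
  forall P a, code_at P a C -> steps P (a, s) (a + size C, s').

Lemma rm_run_stuck P t c : rm_step P c = None -> rm_run P t c = c.
Proof. by case: t => //= t ->. Qed.

Lemma rm_runD P t1 t2 c : rm_run P (t1 + t2) c = rm_run P t2 (rm_run P t1 c).
Proof.
elim: t1 c => //= t1 IH c; case E: (rm_step P c) => [c'|] //.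
by rewrite rm_run_stuck.
Qed.

Lemma rm_runSr P t c :
  rm_run P t.+1 c = if rm_step P (rm_run P t c) is Some c' then c' else rm_run P t c.
Proof. by rewrite -addn1 rm_runD /=; case: rm_step. Qed.

Lemma steps_refl P c : steps P c c. Proof. by exists 0. Qed.

Lemma steps_trans P c2 c1 c3 : steps P c1 c2 -> steps P c2 c3 -> steps P c1 c3.
Proof. by move=> [t1 <-] [t2 <-]; exists (t1 + t2); rewrite rm_runD. Qed.

Lemma steps_step P c c' : rm_step P c = Some c' -> steps P c c'.
Proof. by move=> E; exists 1; rewrite /= E. Qed.

Lemma shiftD a b i : shift (a + b) i = shift a (shift b i).
Proof. by case: i => [r j|r j k] /=; rewrite -?addnA (addnC b). Qed.

Definition cseq (C1 C2 : program) : program := C1 ++ map (shift (size C1)) C2.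

Lemma size_cseq C1 C2 : size (cseq C1 C2) = size C1 + size C2.
Proof. by rewrite size_cat size_map. Qed.

Lemma code_at_seq P a C1 C2 :
  code_at P a (cseq C1 C2) -> code_at P a C1 /\ code_at P (a + size C1) C2.
Proof.
rewrite /code_at size_cseq => -[h1 h2]; split; split; try lia.
  by move=> i hi; rewrite h2 ?nth_cat ?hi //; lia.
move=> i hi; rewrite -addnA h2 ?nth_cat; last lia.
rewrite ifN; last lia.
by rewrite addKn (nth_map (INC 0 0)) // -shiftD.
Qed.

Lemma runs_seq C1 C2 s2 s1 s3 :
  runs C1 s1 s2 -> runs C2 s2 s3 -> runs (cseq C1 C2) s1 s3.
Proof.
move=> h1 h2 P a /code_at_seq[c1 c2].
rewrite size_cseq addnA.
exact: steps_trans (h1 _ _ c1) (h2 _ _ c2).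
Qed.

Lemma runs_nil s : runs [::] s s.
Proof. by move=> P a _; rewrite addn0; apply: steps_refl. Qed.

Lemma runs_inc r s : runs [:: INC r 1] s (upd s r (s r).+1).
Proof.
move=> P a [h1 /(_ 0 erefl)]; rewrite addn0 /= => h2; apply: steps_step => /=.
by rewrite h2 ifT ?[1 + a]addnC //; move: h1 => /=; lia.
Qed.

Arguments runs_nil : clear implicits.
Arguments runs_inc : clear implicits.

(* The last two instructions are an unconditional jump back. *)
Definition loop (r : nat) (C : program) : program :=
  DEC r 1 (size C + 3) :: map (shift 1) C ++ [:: INC r (size C + 2); DEC r 0 0].

Lemma upd_id s r v : v = s r -> upd s r v = s.
Proof. by move=> ->; apply/funext => i; rewrite /upd; case: eqP => // ->. Qed.

Lemma updK s r v w : upd (upd s r v) r w = upd s r w.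
Proof. by apply/funext => i; rewrite /upd; case: eqP. Qed.

Lemma upd_same s r v : upd s r v r = v. Proof. by rewrite /upd eqxx. Qed.

(** The family [st] lists the registers at the loop head, and the body starts with [r] already
    decremented. The closing [INC]/[DEC] pair cancels out, so one pass leads from [st i] to
    [st i.+1]. *)
Lemma runs_loop r C n (st : nat -> regs) :
  (forall i, i < n -> st i r != 0 /\ runs C (upd (st i) r (st i r).-1) (st i.+1)) ->
  st n r = 0 -> runs (loop r C) (st 0) (st n).
Proof.
rewrite /loop => h hn P a [h1 h2]; rewrite /= size_cat size_map /= in h1 h2 *.
have cC : code_at P (a + 1) C.
  split; first lia.
  move=> i hi; rewrite -addnA h2; last lia.
  by rewrite add1n /= nth_cat size_map hi (nth_map (INC 0 0)) // -shiftD.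
have e0 : nth (INC 0 0) P a = DEC r (1 + a) (size C + 3 + a).
  by have := h2 0 erefl; rewrite addn0.
have e1 : nth (INC 0 0) P (a + 1 + size C) = INC r (size C + 2 + a).
  have := h2 (size C).+1; rewrite /= nth_cat size_map ltnn subnn /= => <-; last lia.
  by congr (nth _ _ _); lia.
have e2 : nth (INC 0 0) P (size C + 2 + a) = DEC r a a.
  have := h2 (size C).+2; rewrite /= nth_cat size_map.
  have -> : (size C).+1 < size C = false by lia.
  have -> : (size C).+1 - size C = 1 by lia.
  by rewrite /= => <-; [congr (nth _ _ _); lia|lia].
have body i : i < n -> steps P (a, st i) (a, st i.+1).
  move=> hi; have [nz /(_ _ _ cC) hC] := h _ hi.
  apply: (@steps_trans _ (a + 1, upd (st i) r (st i r).-1)).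
    apply: steps_step; rewrite /= e0 ifT ?(negbTE nz) ?[1 + a]addnC //; lia.
  apply: steps_trans hC _.
  apply: (@steps_trans _ (size C + 2 + a, upd (st i.+1) r (st i.+1 r).+1)).
    by apply: steps_step; rewrite /= e1 ifT //; lia.
  apply: steps_step; rewrite /= e2 ifT ?upd_same /= ?updK ?upd_id //; lia.
have it i : i <= n -> steps P (a, st 0) (a, st i).
  elim: i => [_|i IH hi]; first exact: steps_refl.
  by apply: steps_trans (IH _) (body _ hi); lia.
apply: steps_trans (it n (leqnn n)) _.
by apply: steps_step; rewrite /= e0 ifT ?hn /=; [congr (Some (_, _)); lia|lia].
Qed.

(** * Functions computed by register machines *)

Ltac upd_tac :=
  repeat match goal with
  | |- context [if ?x == ?y then _ else _] =>
      let E := fresh "E" in case: (@eqP _ x y) => [E|E]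
  end.

Lemma runs_clear r s : runs (loop r [::]) s (upd s r 0).
Proof.
have := @runs_loop r [::] (s r) (fun i => upd s r (s r - i)).
rewrite subn0 subnn (@upd_id s r (s r)) //; apply; last by rewrite upd_same.
move=> i hi; rewrite upd_same updK; split; first by lia.
have -> : (s r - i).-1 = s r - i.+1 by lia.
exact: runs_nil.
Qed.

Arguments runs_clear : clear implicits.

Lemma runs_move r d s : r != d -> s d = 0 ->
  runs (loop r [:: INC d 1]) s (upd (upd s r 0) d (s r)).
Proof.
move=> hrd hd.
have := @runs_loop r [:: INC d 1] (s r) (fun i => upd (upd s r (s r - i)) d i).
rewrite subn0 subnn (@upd_id s r (s r)) // (@upd_id s d 0) //; apply; last first.
  by rewrite /upd (negbTE hrd) eqxx.
move=> i hi; have e : upd (upd s r (s r - i)) d i r = s r - i.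
  by rewrite /upd (negbTE hrd) eqxx.
rewrite e; split; first by lia.
have -> : upd (upd s r (s r - i.+1)) d i.+1 =
  upd (upd (upd (upd s r (s r - i)) d i) r (s r - i).-1) d
      (upd (upd (upd s r (s r - i)) d i) r (s r - i).-1 d).+1; last exact: runs_inc.
apply/funext => x; rewrite /upd eqxx; upd_tac; subst; rewrite ?eqxx in hrd *; lia.
Qed.

Definition cleared (d : nat) (s : regs) : Prop := forall i, d <= i -> s i = 0.

(* [f] maps the list of its [n] arguments to its value; the arguments stay in
   registers below [d], the value goes to register [d], and everything from
   [d] on is free scratch space. *)
Definition computable (n : nat) (f : seq nat -> nat) : Prop :=
  forall xs d, size xs = n -> all (fun x => x < d) xs ->
  exists C, forall s, cleared d s -> runs C s (upd s d (f (map s xs))).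

Lemma computable_ext n f g :
  (forall v, size v = n -> f v = g v) -> computable n f -> computable n g.
Proof.
move=> e hf xs d hx hd; have [C hC] := hf xs d hx hd.
by exists C => s /hC; rewrite e // size_map.
Qed.

Lemma map_upd s d v xs : all (fun x => x < d) xs -> map (upd s d v) xs = map s xs.
Proof.
move=> /allP h; apply/eq_in_map => x /h hx; rewrite /upd; case: eqP => // E; lia.
Qed.

(** Emptying [x] is the only way to read it, so it is emptied into both [d] and [d.+1], and the
    second copy is then moved back. *)
Lemma computable_var n i : i < n -> computable n (fun v => nth 0 v i).
Proof.
move=> hi xs d hx hd; set x := nth 0 xs i.
have xd : x < d by move/allP: hd; apply; rewrite mem_nth // hx.
exists (cseq (loop x (cseq [:: INC d 1] [:: INC d.+1 1])) (loop d.+1 [:: INC x 1])).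
move=> s hs; rewrite (nth_map 0) ?hx // -/x.
apply: (@runs_seq _ _ (upd (upd (upd s x 0) d (s x)) d.+1 (s x))).
  have := @runs_loop x (cseq [:: INC d 1] [:: INC d.+1 1]) (s x)
    (fun i => upd (upd (upd s x (s x - i)) d i) d.+1 i).
  rewrite subn0 subnn (@upd_id s x (s x)) // (@upd_id s d 0) ?(hs d) //.
  rewrite (@upd_id s d.+1 0) ?(hs d.+1) //; apply; last first.
    by rewrite /upd; upd_tac; lia.
  move=> k hk; split; first by rewrite /upd; upd_tac; lia.
  apply: runs_seq (runs_inc _ _) _.
  set s1 := (X in runs _ X _); set s2 := (X in runs _ _ X).
  have -> : s2 = upd s1 d.+1 (s1 d.+1).+1; last exact: runs_inc.
  by apply/funext => y; rewrite /s1 /s2 /upd; upd_tac; lia.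
set s1 := (X in runs _ X _); set s2 := (X in runs _ _ X).
have -> : s2 = upd (upd s1 d.+1 0) x (s1 d.+1).
  apply/funext => y; have := hs d.+1; rewrite /s1 /s2 /upd; upd_tac; subst; lia.
by apply: runs_move; [lia|rewrite /s1 /upd; upd_tac; lia].
Qed.

Lemma computable_zero n : computable n (fun=> 0).
Proof.
move=> xs d hx hd; exists [::] => s hs.
by rewrite upd_id ?(hs d) //; apply: runs_nil.
Qed.

Lemma computable_succ n f : computable n f -> computable n (fun v => (f v).+1).
Proof.
move=> hf xs d hx hd; have [C hC] := hf xs d hx hd.
exists (cseq C [:: INC d 1]) => s /hC h; apply: runs_seq h _.
set u := upd s d _; have -> : upd s d (f [seq s i | i <- xs]).+1 = upd u d (u d).+1.
  by rewrite /u updK upd_same.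
exact: runs_inc.
Qed.

Lemma computable_const n c : computable n (fun=> c).
Proof. by elim: c => [|c]; [apply: computable_zero|apply: computable_succ]. Qed.

Lemma computable_behead n f :
  computable n f -> computable n.+1 (fun v => f (behead v)).
Proof.
move=> hf [|x xs] d //= [hx] /andP[_ hd]; exact: hf.
Qed.

(** Register [d] counts the rounds left, [d.+1] holds the index and [d.+2] the accumulator; [f]
    works from [d.+3] on, and its value then replaces the accumulator. All arithmetic below is
    obtained from this form of recursion. *)
Lemma computable_iteri n c b f : computable n c -> computable n b ->
  computable n.+2 f ->
  computable n (fun v => iteri (c v) (fun i acc => f [:: i, acc & v]) (b v)).
Proof.
move=> hc hb hf xs d hx hd.
have [Cc hCc] := hc xs d hx hd.
have hd2 e : d <= e -> all (fun x => x < e) xs.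
  by move=> ?; apply: sub_all hd => x /= ?; lia.
have [|Cb hCb] := hb xs d.+2 hx; first by apply: hd2; lia.
have [||Cf hCf] := hf [:: d.+1, d.+2 & xs] d.+3; rewrite /= ?hx //.
  by rewrite hd2 ?andbT; lia.
exists (cseq (cseq Cc Cb) (cseq
  (loop d (cseq Cf (cseq (loop d.+2 [::]) (cseq (loop d.+3 [:: INC d.+2 1])
                                              [:: INC d.+1 1]))))
  (cseq (loop d.+1 [::]) (loop d.+2 [:: INC d 1])))) => s hs.
have z i : d <= i -> s i = 0 by exact: hs.
apply: runs_seq.
  apply: runs_seq (hCc s hs) (hCb _ _) => i hi.
  by rewrite /upd z; [upd_tac; lia|lia].
rewrite map_upd //; set v := map s xs.
pose acc i := iteri i (fun i a => f [:: i, a & v]) (b v).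
pose st i := upd (upd (upd s d (c v - i)) d.+1 i) d.+2 (acc i).
apply: (@runs_seq _ _ (st (c v))).
  have := @runs_loop d (cseq Cf (cseq (loop d.+2 [::])
    (cseq (loop d.+3 [:: INC d.+2 1]) [:: INC d.+1 1]))) (c v) st.
  have -> : st 0 = upd (upd s d (c v)) d.+2 (b v).
    apply/funext => y; have := z d.+1.
    by rewrite /st /upd /acc /= subn0; upd_tac; subst; lia.
  apply; last by rewrite /st /upd; upd_tac; lia.
  move=> i hi; split; first by rewrite /st /upd; upd_tac; lia.
  set u := upd (st i) _ _.
  have uE : u = upd (upd (upd s d (c v - i.+1)) d.+1 i) d.+2 (acc i).
    by apply/funext => y; rewrite /u /st /upd; upd_tac; lia.
  have /hCf h1 : cleared d.+3 u.
    by move=> y hy; rewrite uE /upd z; [upd_tac; lia|lia].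
  apply: runs_seq h1 _.
  have -> : f [:: u d.+1, u d.+2 & map u xs] = acc i.+1.
    rewrite uE !map_upd ?hd2 //; try lia; rewrite /acc /=; congr f.
    by congr [:: _, _ & _]; rewrite /upd; upd_tac; lia.
  apply: runs_seq (runs_clear _ _) _.
  apply: runs_seq (runs_move _ _) _; [lia|by rewrite upd_same|].
  set s1 := (X in runs _ X _).
  have -> : st i.+1 = upd s1 d.+1 (s1 d.+1).+1; last exact: runs_inc.
  apply/funext => y; have := z d.+3; rewrite /s1 /st uE /upd; upd_tac; subst; lia.
apply: runs_seq (runs_clear _ _) _.
set s1 := (X in runs _ X _); set s2 := (X in runs _ _ X).
have -> : s2 = upd (upd s1 d.+2 0) d (s1 d.+2).
  rewrite /s2 -/(acc (c v)).
  apply/funext => y; have := z d.+1; have := z d.+2.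
  by rewrite /s1 /st /upd; upd_tac; subst; lia.
by apply: runs_move; [lia|rewrite /s1 /st /upd; upd_tac; lia].
Qed.

Lemma computable_add n a b : computable n a -> computable n b ->
  computable n (fun v => a v + b v).
Proof.
move=> ha hb.
have h : computable n.+2 (fun v => (nth 0 v 1).+1).
  exact/computable_succ/computable_var.
apply: computable_ext (computable_iteri hb ha h) => v _ /=.
by elim: (b v) => [|m /= ->]; rewrite ?addn0 ?addnS.
Qed.

Lemma computable_sub n a b : computable n a -> computable n b ->
  computable n (fun v => a v - b v).
Proof.
move=> ha hb.
(* The predecessor is the last index met by an iteration of that length. *)
have hp m f : computable m f -> computable m (fun v => (f v).-1).
  move=> hf; have h : computable m.+2 (fun v => nth 0 v 0) by apply: computable_var.
  apply: computable_ext (computable_iteri hf (computable_zero (n := m)) h) => v _ /=.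
  by case: (f v).
have h : computable n.+2 (fun v => (nth 0 v 1).-1) by apply/hp/computable_var.
apply: computable_ext (computable_iteri hb ha h) => v _ /=.
by elim: (b v) => [|m /= ->] /=; lia.
Qed.

Lemma computable_mul n a b : computable n a -> computable n b ->
  computable n (fun v => a v * b v).
Proof.
move=> ha hb.
have h : computable n.+2 (fun v => nth 0 v 1 + a (behead (behead v))).
  apply: computable_add; first exact: computable_var.
  exact: (computable_behead (computable_behead ha)).
apply: computable_ext (computable_iteri hb (computable_zero (n := n)) h) => v _ /=.
by elim: (b v) => [|m /= ->] /=; lia.
Qed.

Lemma computable_pow2 n a : computable n a -> computable n (fun v => 2 ^ a v).
Proof.
move=> ha.
have h : computable n.+2 (fun v => nth 0 v 1 + nth 0 v 1).
  by apply: computable_add; apply: computable_var.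
apply: computable_ext (computable_iteri ha (computable_const (n := n) 1) h) => v _ /=.
by elim: (a v) => [|m /= ->] //; rewrite expnS; lia.
Qed.

(** * Integer square root and a pairing function *)

(** Truncated subtraction is the test: the root grows at index [i] exactly when
    [r.+1 * r.+1 <= i.+1]. *)
Definition isqrt (z : nat) : nat :=
  iteri z (fun i r => r + (1 - (r.+1 * r.+1 - i.+1))) 0.

Lemma isqrt_spec z : isqrt z * isqrt z <= z < (isqrt z).+1 * (isqrt z).+1.
Proof. by rewrite /isqrt; elim: z => //= z; set r := iteri _ _ _; nia. Qed.

(** Because [a <= a + b], the value lies below the next square, so its integer root is [a + b]. *)
Definition npair (a b : nat) : nat := (a + b) * (a + b) + a.
Definition nfst (z : nat) : nat := z - isqrt z * isqrt z.
Definition nsnd (z : nat) : nat := isqrt z - nfst z.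

Lemma isqrt_npair a b : isqrt (npair a b) = a + b.
Proof. have := isqrt_spec (npair a b); rewrite /npair; set r := isqrt _; nia. Qed.

Lemma nfst_npair a b : nfst (npair a b) = a.
Proof. by rewrite /nfst isqrt_npair /npair; lia. Qed.

Lemma nsnd_npair a b : nsnd (npair a b) = b.
Proof. by rewrite /nsnd nfst_npair isqrt_npair; lia. Qed.

Lemma computable_isqrt n a : computable n a -> computable n (fun v => isqrt (a v)).
Proof.
move=> ha.
have h : computable n.+2 (fun v => nth 0 v 1 +
   (1 - ((nth 0 v 1).+1 * (nth 0 v 1).+1 - (nth 0 v 0).+1))).
  by do ![exact: computable_var | exact: computable_const | apply: computable_sub |
    apply: computable_mul | apply: computable_add | apply: computable_succ].
exact: computable_ext (computable_iteri ha (computable_zero (n := n)) h).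
Qed.

Lemma computable_nfst n a : computable n a -> computable n (fun v => nfst (a v)).
Proof.
move=> ha; apply: computable_sub => //.
by apply: computable_mul; apply: computable_isqrt.
Qed.

Lemma computable_nsnd n a : computable n a -> computable n (fun v => nsnd (a v)).
Proof.
by move=> ha; apply: computable_sub; [apply: computable_isqrt|apply: computable_nfst].
Qed.

(** * The code of a protocol as a function of its chain length *)

(** These functions imitate [pickle]: a sequence is coded by iterating [code_cons] from 0, a pair as
    a sequence of two codes, and [true] as 1. *)
Definition code_cons (x m : nat) : nat := 2 ^ x * m.*2.+1.
Definition code_pair (a b : nat) : nat := code_cons a (code_cons b 0).
Definition code_send (s l q : nat) : nat := code_pair (code_pair s (code_pair 1 l)) q.

Definition code_wrong (n s c : nat) : nat :=
  iteri n (fun j acc => code_cons (code_send s j.+1 (1 - j)) acc) c.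

Definition code_chain (M n c k : nat) : nat :=
  iteri k (fun i acc => code_cons (code_send (M + i).+1 0 (M + i))
                                  (code_wrong n (M + i).+1 acc)) c.

(** [A] codes the alphabet sizes, [M] is the number of states outside the chain, [n] the number of
    wrong letters in a chain state, [h] codes source and label of the transition into the initial
    state, [c] the transitions outside the chain, and [p] machine 1. The chain length [k] is kept
    apart as the variable. *)
Definition code_protocol (A M n h c p k : nat) : nat :=
  code_pair (code_pair A
    (code_pair (code_pair (M + k).+1 (M + k))
               (code_cons (code_pair h (M + k)) (code_chain M n c k)))) p.

Definition params (A M n h c p : nat) : nat :=
  npair A (npair M (npair n (npair h (npair c p)))).

(** The fixed point of the diagonal argument: [k] is unpacked into the parameters and serves as the
    chain length as well. *)
Definition self_code (k : nat) : nat :=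
  code_protocol (nfst k) (nfst (nsnd k)) (nfst (nsnd (nsnd k)))
    (nfst (nsnd (nsnd (nsnd k)))) (nfst (nsnd (nsnd (nsnd (nsnd k)))))
    (nsnd (nsnd (nsnd (nsnd (nsnd k))))) k.

Lemma self_code_params A M n h c p :
  self_code (params A M n h c p) = code_protocol A M n h c p (params A M n h c p).
Proof. by rewrite /self_code {1 2 3 4 5 6}/params !(nfst_npair, nsnd_npair). Qed.

Lemma computable_cons n a b : computable n a -> computable n b ->
  computable n (fun v => code_cons (a v) (b v)).
Proof.
move=> ha hb; apply: computable_mul; first exact: computable_pow2.
apply: computable_succ.
have h : computable n (fun v => b v + b v) by apply: computable_add.
by apply: computable_ext h => v _; rewrite addnn.
Qed.

Lemma computable_pair n a b : computable n a -> computable n b ->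
  computable n (fun v => code_pair (a v) (b v)).
Proof.
by move=> ha hb; do 2![apply: computable_cons => //]; apply: computable_zero.
Qed.

Lemma computable_send n a b c :
  computable n a -> computable n b -> computable n c ->
  computable n (fun v => code_send (a v) (b v) (c v)).
Proof.
by move=> ha hb hc; do !apply: computable_pair => //; apply: computable_const.
Qed.

Lemma computable_wrong n a b c :
  computable n a -> computable n b -> computable n c ->
  computable n (fun v => code_wrong (a v) (b v) (c v)).
Proof.
move=> ha hb hc.
have h : computable n.+2 (fun v => code_cons
    (code_send (b (behead (behead v))) (nth 0 v 0).+1 (1 - nth 0 v 0)) (nth 0 v 1)).
  apply: computable_cons; last exact: computable_var.
  apply: computable_send; first exact: (computable_behead (computable_behead hb)).
    exact/computable_succ/computable_var.
  by apply: computable_sub; [apply: computable_const|apply: computable_var].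
exact: computable_ext (computable_iteri ha hc h).
Qed.

Lemma computable_chain n a b c k :
  computable n a -> computable n b -> computable n c -> computable n k ->
  computable n (fun v => code_chain (a v) (b v) (c v) (k v)).
Proof.
move=> ha hb hc hk.
have hs : computable n.+2 (fun v => a (behead (behead v)) + nth 0 v 0).
  apply: computable_add; last exact: computable_var.
  exact: (computable_behead (computable_behead ha)).
have h : computable n.+2 (fun v => code_cons
    (code_send (a (behead (behead v)) + nth 0 v 0).+1 0 (a (behead (behead v)) + nth 0 v 0))
    (code_wrong (b (behead (behead v))) (a (behead (behead v)) + nth 0 v 0).+1 (nth 0 v 1))).
  apply: computable_cons.
    by apply: computable_send => //; [apply: computable_succ|apply: computable_zero].
  apply: computable_wrong; last exact: computable_var; last exact: computable_succ.
  exact: (computable_behead (computable_behead hb)).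
exact: computable_ext (computable_iteri hk hc h).
Qed.

Lemma computable_self_code : computable 1 (fun v => self_code (nth 0 v 0)).
Proof.
have h : computable 1 (fun v => nth 0 v 0) by apply: computable_var.
by do ![exact: h | apply: computable_pair | apply: computable_cons | apply: computable_nfst |
  apply: computable_nsnd | apply: computable_succ | apply: computable_add |
  apply: computable_chain].
Qed.

(** * Running a decider on the code of one's own protocol *)

Definition input (k : nat) : regs := upd (fun=> 0) 0 k.
Definition conf (P : program) (k t : nat) : nat * regs := rm_run P t (0, input k).
Definition halts (P : program) (k : nat) : Prop :=
  exists t, rm_step P (conf P k t) = None.
Definition reg_total (R : nat) (s : regs) : nat := \sum_(r < R) s r.

Definition clamp (n : nat) (i : instr) : instr :=
  match i with
  | INC r j => INC r (minn j n)
  | DEC r j k => DEC r (minn j n) (minn k n)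
  end.

(** A halting program may jump anywhere beyond its end. Clamping redirects all such jumps to the
    first address after the code, where another block can take over. *)
Lemma runs_clamp D s t : rm_step D (rm_run D t (0, s)) = None ->
  runs (map (clamp (size D)) D) s (rm_run D t (0, s)).2.
Proof.
move=> hN P a; rewrite /code_at size_map => -[h1 h2].
have key u : steps P (a, s)
    (a + minn (rm_run D u (0, s)).1 (size D), (rm_run D u (0, s)).2).
  elim: u => [|u IH]; first by rewrite /= min0n addn0; apply: steps_refl.
  rewrite rm_runSr; case E: (rm_run D u (0, s)) IH => [pc f] /= IH.
  case: ifP => // hpc; rewrite /= in IH.
  move: (h2 pc hpc) IH; rewrite (nth_map (INC 0 0)) //.
  have -> : minn pc (size D) = pc by lia.
  move=> hI IH; apply: steps_trans IH (steps_step _); rewrite /= hI ifT; last lia.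
  case: (nth _ D pc) => [r j|r j k] /=; first by rewrite addnC.
  by case: (f r == 0) => /=; rewrite addnC.
move: hN (key t); case: (rm_run D t (0, s)) => pc f /=.
case: ltnP => [hpc|hpc _ //].
by case: nth => // r j k; case: ifP.
Qed.

(** The code is computed into register 1 and moved to register 0. All other registers are zero
    again, which is exactly the initial configuration that [D] expects. *)
Lemma run_on_self_code (D : program) : exists C, forall k m,
  rm_halts_with D (self_code k) m -> exists2 s, s 0 = m & runs C (input k) s.
Proof.
have [//|//|C hC] := computable_self_code (xs := [:: 0]) (d := 1).
exists (cseq (cseq C (cseq (loop 0 [::]) (loop 1 [:: INC 0 1])))
             (map (clamp (size D)) D)) => k m [t [hN <-]].
exists (rm_run D t (0, input (self_code k))).2 => //.
apply: runs_seq (runs_clamp hN).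
apply: runs_seq (hC (input k) _) _; first by case.
have -> : [seq input k i | i <- [:: 0]] = [:: k] by [].
apply: runs_seq (runs_clear _ _) _.
set s1 := (X in runs _ X _); set s2 := (X in runs _ _ X).
have -> : s2 = upd (upd s1 1 0) 0 (s1 1); last exact: runs_move.
by apply/funext => -[|[|i]].
Qed.

Lemma code_at_refl C : code_at C 0 C.
Proof.
by split=> // i _; rewrite add0n; case: nth => [r j|r j k]; rewrite /= !addn0.
Qed.

Lemma never_stuck P c c' : steps P c c' ->
  (forall t, rm_step P (rm_run P t c') <> None) ->
  forall t, rm_step P (rm_run P t c) <> None.
Proof.
move=> [u <-] h t hN; apply: (h t); rewrite -rm_runD addnC rm_runD.
by rewrite rm_run_stuck.
Qed.

Lemma rm_run_idle P a r s t : a < size P -> nth (INC 0 0) P a = DEC r a a ->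
  exists2 s', rm_run P t (a, s) = (a, s') & forall i, s' i <= s i.
Proof.
move=> ha hI; elim: t s => [|t IH] s /=; first by exists s.
rewrite ha hI; case: ifP => _; first exact: IH.
have [s' -> hs'] := IH (upd s r (s r).-1); exists s' => // i.
by apply: leq_trans (hs' i) _; rewrite /upd; case: eqP => // ->; lia.
Qed.

Lemma rm_run_grow P a s t : a < size P -> nth (INC 0 0) P a = INC 0 a ->
  exists2 s', rm_run P t (a, s) = (a, s') & s' 0 = s 0 + t.
Proof.
move=> ha hI; elim: t s => [|t IH] s /=; first by exists s; rewrite ?addn0.
rewrite ha hI; have [s' -> e] := IH (upd s 0 (s 0).+1); exists s' => //.
by rewrite e upd_same addSnnS.
Qed.

Lemma reg_total_upd_le R s r v : v <= (s r).+1 -> reg_total R (upd s r v) <= (reg_total R s).+1.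
Proof.
move=> hv; rewrite /reg_total; case: (ltnP r R) => hr; last first.
  apply: leqW; apply: leq_sum => i _; rewrite /upd; case: eqP => // E.
  by have := ltn_ord i; lia.
rewrite (bigD1 (Ordinal hr)) //= [X in _ <= X.+1](bigD1 (Ordinal hr)) //= upd_same -addSn.
apply: leq_add => //; apply: leq_sum => i ne; rewrite /upd; case: eqP => // E.
by case/eqP: ne; apply/val_inj.
Qed.

Lemma reg_total_run_le P R t c : reg_total R (rm_run P t c).2 <= reg_total R c.2 + t.
Proof.
elim: t => [|t IH]; first by rewrite addn0.
rewrite rm_runSr; case: (rm_run P t c) IH => pc f /= IH.
case: ifP => _ /=; last lia.
case: nth => [r j|r j k] /=.
  by have := @reg_total_upd_le R f r _ (leqnn _); lia.
case: ifP => _ /=; first lia.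
have h : (f r).-1 <= (f r).+1 by lia.
by have := reg_total_upd_le R h; lia.
Qed.

Lemma reg_total_input R k : reg_total R (input k) <= k.
Proof.
rewrite /reg_total; case: R => [|R]; first by rewrite big_ord0.
by rewrite big_ord_recl big1 ?addn0.
Qed.

(** The registers sum to at most [k] at the start, each step adds at most one, and after step [T]
    nothing increases. *)
Lemma bounded_run P k R a s T :
  (forall t, exists2 s', rm_run P t (a, s) = (a, s') & forall i, s' i <= s i) ->
  conf P k T = (a, s) -> forall t, reg_total R (conf P k t).2 <= k + T.
Proof.
move=> hidle hT t.
have hle u : reg_total R (conf P k u).2 <= k + u.
  by apply: leq_trans (reg_total_run_le _ _ _ _) _; rewrite leq_add2r reg_total_input.
case: (leqP t T) => htT; first by apply: leq_trans (hle t) _; lia.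
have -> : t = T + (t - T) by lia.
rewrite /conf rm_runD -/(conf P k T) hT; have [s' -> h] := hidle (t - T).
apply: leq_trans (_ : reg_total R s <= _); first by apply: leq_sum.
by have := hle T; rewrite hT.
Qed.

Lemma diagonal_halting (D : program) : exists2 B, 0 < size B & forall k m,
  rm_halts_with D (self_code k) m -> (halts B k <-> m = 1).
Proof.
have [C hC] := run_on_self_code D.
(* The tail inspects the answer in register 0: for answer 1 it leaves the program, for any other
   answer it spins on its third instruction. *)
pose tl := [:: DEC 0 1 2; DEC 0 2 3; DEC 0 2 2]; pose B := cseq C tl.
exists B; first by rewrite size_cseq addnC.
move=> k m /hC[s hs hr].
have [cC [hsz cT]] := code_at_seq (code_at_refl (cseq C tl)).
have := hr _ _ cC; rewrite !add0n -/B in cT hsz * => h1.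
have szB : size B = size C + 3 by rewrite size_cseq.
have e0 : nth (INC 0 0) B (size C) = DEC 0 (size C + 1) (size C + 2).
  by rewrite -[X in nth _ _ X]addn0 (cT 0 isT) /=; congr (DEC _ _ _); lia.
have e1 : nth (INC 0 0) B (size C + 1) = DEC 0 (size C + 2) (size C + 3).
  by rewrite (cT 1 isT) /=; congr (DEC _ _ _); lia.
have e2 : nth (INC 0 0) B (size C + 2) = DEC 0 (size C + 2) (size C + 2).
  by rewrite (cT 2 isT) /=; congr (DEC _ _ _); lia.
have idle s' : steps B (0, input k) (size C + 2, s') -> ~ halts B k.
  move=> h [t]; apply: never_stuck h _ t => t.
  have [||u -> _] := @rm_run_idle B (size C + 2) 0 s' t; first lia.
    exact: e2.
  rewrite /= e2 ifT; last lia.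
  by case: ifP.
case: (posnP m) => [m0|mpos].
  split; [|lia]; move=> hh; exfalso; apply: (@idle s _) hh.
  apply: steps_trans h1 (steps_step _).
  by rewrite /= e0 hs m0 ifT /= //; lia.
have h2 : steps B (0, input k) (size C + 1, upd s 0 m.-1).
  apply: steps_trans h1 (steps_step _).
  by rewrite /= e0 hs ifT; [rewrite ifN //|]; lia.
case: (eqVneq m 1) => [m1|m1].
  split=> // _.
  have [t ht] : steps B (0, input k) (size C + 3, upd s 0 m.-1).
    apply: steps_trans h2 (steps_step _).
    by rewrite /= e1 upd_same m1 ifT /= //; lia.
  by exists t; rewrite /conf ht /= szB ltnn.
split; last by move/eqP; rewrite (negbTE m1).
move=> hh; exfalso; apply: (@idle (upd s 0 m.-2) _) hh.
apply: steps_trans h2 (steps_step _).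
by rewrite /= e1 upd_same updK ifT; [rewrite ifN //|]; lia.
Qed.

Definition jumps (i : instr) : seq nat :=
  match i with INC _ j => [:: j] | DEC _ j k => [:: j; k] end.

Lemma never_halts (B : program) k : 0 < size B ->
  all (fun i => all (ltn^~ (size B)) (jumps i)) B -> ~ halts B k.
Proof.
move=> hB hj [t].
have hpc u : (conf B k u).1 < size B.
  elim: u => // u; rewrite /conf rm_runSr; case: rm_run => pc f /= hpc.
  rewrite hpc; have := all_nthP (INC 0 0) hj pc hpc.
  by case: nth => [r j|r j k'] /=; [case/andP|case/and3P => h1 h2 _; case: ifP].
case: (conf B k t) (hpc t) => pc f /= ->.
by case: nth => // r j k'; case: ifP.
Qed.

(** Absence of halting is asserted for every [k], whatever [D] does, because the promise of deadlock
    freedom must be established before the decider may be consulted. *)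
Lemma diagonal_growth (D : program) : exists2 B,
  0 < size B /\ (forall k, ~ halts B k) & forall k m,
  rm_halts_with D (self_code k) m ->
  (m = 1 -> forall N, exists t, N <= (conf B k t).2 0) /\
  (m <> 1 -> exists N, forall R t, reg_total R (conf B k t).2 <= N).
Proof.
have [C0 hC0] := run_on_self_code D.
(* This clamping bounds every jump target by the length of the block; with the tail behind it, no
   jump leaves the program. *)
pose C := map (clamp (size C0)) C0.
have hC k m : rm_halts_with D (self_code k) m -> exists2 s, s 0 = m & runs C (input k) s.
  move=> /hC0[s hs /(_ _ _ (code_at_refl C0))[t]]; rewrite !add0n => ht.
  exists s => //; have := @runs_clamp C0 (input k) t; rewrite ht /= ltnn; exact.
(* Answer 1 now leads to an instruction that increments register 0 forever. *)
pose tl := [:: DEC 0 1 2; DEC 0 2 3; DEC 0 2 2; INC 0 3]; pose B := cseq C tl.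
exists B.
  have sB : size B = size C0 + 4 by rewrite size_cseq size_map.
  split=> [|k]; first by rewrite sB addnC.
  apply: never_halts; rewrite sB ?addnS // /B /cseq all_cat /C all_map.
  rewrite (@eq_all _ _ predT) ?all_predT /=; first by rewrite size_map; lia.
  by case=> [r j|r j k'] /=; lia.
move=> k m /hC[s hs hr].
have [cC [hsz cT]] := code_at_seq (code_at_refl (cseq C tl)).
have := hr _ _ cC; rewrite !add0n -/B in cT hsz * => h1.
have szB : size B = size C + 4 by rewrite size_cseq.
have e0 : nth (INC 0 0) B (size C) = DEC 0 (size C + 1) (size C + 2).
  by rewrite -[X in nth _ _ X]addn0 (cT 0 isT) /=; congr (DEC _ _ _); lia.
have e1 : nth (INC 0 0) B (size C + 1) = DEC 0 (size C + 2) (size C + 3).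
  by rewrite (cT 1 isT) /=; congr (DEC _ _ _); lia.
have e2 : nth (INC 0 0) B (size C + 2) = DEC 0 (size C + 2) (size C + 2).
  by rewrite (cT 2 isT) /=; congr (DEC _ _ _); lia.
have e3 : nth (INC 0 0) B (size C + 3) = INC 0 (size C + 3).
  by rewrite (cT 3 isT) /=; congr (INC _ _); lia.
have idle s' : steps B (0, input k) (size C + 2, s') ->
    exists N, forall R t, reg_total R (conf B k t).2 <= N.
  have hI t : exists2 u, rm_run B t (size C + 2, s') = (size C + 2, u)
                       & forall i, u i <= s' i.
    by apply: (@rm_run_idle B (size C + 2) 0 s' t); [lia|exact: e2].
  by move=> [T hT]; exists (k + T) => R t; apply: bounded_run hI hT t.
case: (posnP m) => [m0|mpos].
  split=> [|_]; first lia.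
  apply: (idle s).
  apply: steps_trans h1 (steps_step _).
  by rewrite /= e0 hs m0 ifT /= //; lia.
have h2 : steps B (0, input k) (size C + 1, upd s 0 m.-1).
  apply: steps_trans h1 (steps_step _).
  by rewrite /= e0 hs ifT; [rewrite ifN //|]; lia.
case: (eqVneq m 1) => [m1|m1]; last first.
  split=> [e|_]; first by rewrite e eqxx in m1.
  apply: (idle (upd s 0 m.-2)).
  apply: steps_trans h2 (steps_step _).
  by rewrite /= e1 upd_same updK ifT; [rewrite ifN //|]; lia.
have h3 : steps B (0, input k) (size C + 3, upd s 0 m.-1).
  apply: steps_trans h2 (steps_step _).
  by rewrite /= e1 upd_same m1 ifT /= //; lia.
have hG t : exists2 u, rm_run B t (size C + 3, upd s 0 m.-1) = (size C + 3, u)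
                     & u 0 = upd s 0 m.-1 0 + t.
  by apply: rm_run_grow; [lia|exact: e3].
split=> // _ N; case: h3 => T hT; exists (T + N).
by rewrite /conf rm_runD hT; have [u -> e] := hG N; rewrite /= e; lia.
Qed.

(** * Queue transducers and their completions *)

(* In control state [q] the letter [l] is received, the word [(tr_next q l).1] is
   sent, and the control state becomes [(tr_next q l).2].  The letters are
   [0, ..., tr_letters - 1], of which [1] (the stray letter) is never sent by
   the transducer; the message [tr_letters] is an end marker. *)
Record transducer := Transducer {
  tr_next : nat -> nat -> seq nat * nat;
  tr_init : nat;
  tr_word : seq nat;
  tr_size : nat;
  tr_letters : nat }.

Definition good (X : transducer) (l : nat) : bool := (l < tr_letters X) && (l != 1).

(** Words of at most two letters keep the state set finite. [valid_echo] yields a state with a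
    letter pending, at which a wrong letter can be sent. The last clause of [valid_next] keeps the
    chain states apart from the later ones. *)
Record valid (X : transducer) : Prop := Valid {
  valid_letters : 2 < tr_letters X;
  valid_word : all (good X) (tr_word X);
  valid_wsize : size (tr_word X) <= 2;
  valid_init : tr_init X < tr_size X;
  valid_echo : (tr_next X (tr_init X) 0).1 = [:: 0];
  valid_next q l : q < tr_size X -> good X l ->
    [/\ size (tr_next X q l).1 <= 2, all (good X) (tr_next X q l).1,
        (tr_next X q l).2 < tr_size X & (tr_next X q l).2 != tr_init X] }.

Definition state := ((bool * bool) + bool + (seq nat * nat))%type.

(* [Stray sd rd] and [Back f] are the two phases of a machine that has left the
   transducer; the flags record which stray letters were sent and received.
   In [Clean w q] the word [w] remains to be sent. *)
Notation Stray sd rd := (inl (inl (sd, rd)) : state).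
Notation Back f := (inl (inr f) : state).
Notation Clean w q := (inr (w, q) : state).

(* [None]: strays never occur in a run.  [Some m]: a stray machine first performs
   only events of sign [m] up to the end marker, then only of the other sign. *)
Definition mode := option bool.

Definition back_sign (md : mode) : bool := if md is Some m then ~~ m else false.

Definition stray_step (md : mode) (X : transducer) (s : state) (e : label) :
    option state :=
  let: (sg, l) := e in
  match s with
  | inr (b :: w, q) =>
      if ~~ sg then None else if l == b then Some (Clean w q) else
      if md is Some _ then
        if l < tr_letters X then Some (Stray (l == 1) false) else None
      else None
  | inr ([::], q) =>
      if sg then None else
      if l == 1 then Some (if md is Some _ then Stray false true else Back true) else
      if l < tr_letters X then Some (inr (tr_next X q l)) else None
  | inl (inl (sd, rd)) =>
      if md is Some m then
        if sg != m then None else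
        if l < tr_letters X then
          Some (Stray (sd || (m && (l == 1))) (rd || (~~ m && (l == 1)))) else
        if (l == tr_letters X) && (if m then sd else rd)
        then Some (Back (if m then rd else sd)) else None
      else None
  | inl (inr f) =>
      if (sg == back_sign md) && (l < tr_letters X) then Some (Back (f || (l == 1)))
      else None
  end.

(** The transition into [home] is split off: outside the chain it is the only one whose target
    depends on the chain length. *)
Definition tr_step (md : mode) (X : transducer) (home s : state) (e : label) :
    option state :=
  if (s == Back true) && (e == (back_sign md, tr_letters X)) then Some home
  else stray_step md X s e.

Fixpoint arun (md : mode) (X : transducer) (home s : state) (w : seq label) :
    option state :=
  if w is e :: w' then
    if tr_step md X home s e is Some s' then arun md X home s' w' else None
  else Some s.

(** Only these clean states, and the chain, become states of the machine, since strong connectivity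
    requires every state to be reachable. *)
Inductive clean_reach (X : transducer) : seq nat * nat -> Prop :=
| clean_start : clean_reach X (tr_word X, tr_init X)
| clean_send b w q : clean_reach X (b :: w, q) -> clean_reach X (w, q)
| clean_recv q l : clean_reach X ([::], q) -> good X l ->
    clean_reach X (tr_next X q l).

(** * The numbered machine of a transducer *)

Section Machine.
Variables (md : mode) (X : transducer).

Let L := tr_letters X.

Definition start : state := Clean (tr_word X) (tr_init X).
(** The initial state will be [chain_state k]; it first puts [k] letters 0, the input, into the
    queue. *)
Definition chain_state (i : nat) : state :=
  Clean (nseq i 0 ++ tr_word X) (tr_init X).

Definition short_words : seq (seq nat) :=
  [::] :: [seq [:: a] | a <- iota 0 L] ++
    [seq [:: a; b] | a <- iota 0 L, b <- iota 0 L].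

Definition strays : seq state :=
  if md is Some _ then
    [:: Stray false false; Stray true false; Stray false true; Stray true true;
        Back false; Back true]
  else [:: Back true].

(** Membership is decided classically. This is harmless: the list need not be computed from the
    program, as its effect on the code of the protocol is handed over as a number. *)
Definition clean_rest : seq state :=
  [seq s <- undup [seq Clean w q | w <- short_words, q <- iota 0 (tr_size X)] |
     (s != start) && (if s is inr c then `[< clean_reach X c >] else false)].

Definition nbase : nat := size (strays ++ clean_rest).
(** The chain comes last, so that the numbers of all states are unaffected when it is lengthened. *)
Definition states (k : nat) : seq state :=
  (strays ++ clean_rest) ++ [seq chain_state i | i <- iota 0 k.+1].
Definition num (k : nat) (s : state) : nat := index s (states k).

Definition labels : seq label := [seq (s, l) | s <- [:: true; false], l <- iota 0 L.+1].

Definition base_trans : seq transition :=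
  pmap (fun se : state * label =>
          omap (fun s' => (num 0 se.1, se.2, num 0 s')) (stray_step md X se.1 se.2))
       [seq (s, e) | s <- states 0, e <- labels].

(** A chain state above [start] expects the letter 0, so its wrong letters are [1], ..., [L.-1]. *)
Definition nwrong : nat := if md is Some _ then L.-1 else 0.

(* States 0 and 1 are [Stray false false] and [Stray true false], so [1 - n'] is
   where sending the wrong letter [n'.+1] leads. *)
Fixpoint wrong_trans (s n : nat) : seq transition :=
  if n is n'.+1 then (s, (true, n), 1 - n') :: wrong_trans s n' else [::].

Fixpoint chain_trans (k : nat) : seq transition :=
  if k is k'.+1 then
    (nbase + k, (true, 0), nbase + k')
      :: wrong_trans (nbase + k) nwrong ++ chain_trans k'
  else [::].

Definition home_label : label := (back_sign md, L).

Definition tr_machine (k : nat) : machine :=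
  ((nbase + k).+1, nbase + k,
   (num 0 (Back true), home_label, nbase + k) :: chain_trans k ++ base_trans).

Hypothesis X_valid : valid X.

(** The second part separates the chain from the other clean states: the initial control state is
    never re-entered, so what is pending there is a rest of [tr_word X], whereas [chain_state X i]
    with positive [i] carries a longer word. *)
Lemma clean_reach_valid w q : clean_reach X (w, q) ->
  [/\ size w <= 2, all (good X) w & q < tr_size X] /\
  (q = tr_init X -> size w <= size (tr_word X)).
Proof.
case: X_valid => h1 h2 h3 h4 h5 h6.
move ec: (w, q) => c h; elim: h w q ec => {c}.
- by move=> w q [-> ->].
- move=> b w q _ IH w' q' [-> ->].
  have [[s1 s2 s3] s4] := IH _ _ erefl; split; last by move=> /s4 /=; lia.
  by split=> //; [move: s1 => /=; lia|case/andP: s2].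
move=> q l _ IH gl w' q' e; have [[_ _ s3] _] := IH _ _ erefl.
have := h6 q l s3 gl; rewrite -e => -[a1 a2 a3 a4]; split=> // e'.
by rewrite e' eqxx in a4.
Qed.

Lemma mem_short_words w : size w <= 2 -> all (good X) w -> w \in short_words.
Proof.
rewrite /short_words; case: w => [|a [|b [|c w]]] //=.
  rewrite andbT => _ /andP[ha _]; rewrite in_cons mem_cat map_f ?orbT //.
  by rewrite mem_iota.
move=> _ /and3P[/andP[ha _] /andP[hb _] _]; rewrite in_cons mem_cat.
rewrite (allpairs_f (fun a b => [:: a; b])) ?orbT // mem_iota //.
Qed.

Lemma mem_clean_rest w q :
  (Clean w q \in clean_rest) = (Clean w q != start) && `[< clean_reach X (w, q) >].
Proof.
rewrite mem_filter; apply: andb_idr => /andP[_ /asboolP h].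
rewrite mem_undup; have [[h1 h2 h3] _] := clean_reach_valid h.
rewrite (allpairs_f (fun w q => Clean w q)) ?mem_iota // ?mem_short_words //.
Qed.

Lemma clean_rest_clean s : s \in clean_rest ->
  exists2 c, s = inr c & clean_reach X c /\ s != start.
Proof.
rewrite mem_filter => /andP[/andP[h1 h2] _]; case: s h1 h2 => // c h1 /asboolP h2.
by exists c.
Qed.

Lemma chain_state_inj i j : chain_state i = chain_state j -> i = j.
Proof. by case => /(congr1 size); rewrite !size_cat !size_nseq; lia. Qed.

Lemma chain_state_fresh i : chain_state i \notin strays ++ clean_rest.
Proof.
rewrite mem_cat negb_or; apply/andP; split; first by rewrite /strays; case: md.
apply/negP => /clean_rest_clean[c [ec] [h /eqP ns]].
rewrite -ec in h; have [_ /(_ erefl)] := clean_reach_valid h.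
rewrite size_cat size_nseq => hi; apply: ns; rewrite /chain_state.
have -> : i = 0 by lia.
by [].
Qed.

Lemma uniq_states k : uniq (states k).
Proof.
rewrite /states cat_uniq; apply/and3P; split.
- rewrite cat_uniq; apply/and3P; split; first by rewrite /strays; case: md.
    apply/hasPn => s /clean_rest_clean[c -> _] /=; rewrite /strays; by case: md.
  by apply: filter_uniq; rewrite undup_uniq.
- apply/hasPn => _ /mapP[i _ ->]; exact: chain_state_fresh.
- by rewrite map_inj_uniq ?iota_uniq //; apply: chain_state_inj.
Qed.

Lemma size_states k : size (states k) = (nbase + k).+1.
Proof. by rewrite size_cat size_map size_iota addnS. Qed.

Lemma num_chain k i : i <= k -> num k (chain_state i) = nbase + i.
Proof.
move=> hi; rewrite /num /states index_cat (negbTE (chain_state_fresh i)).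
congr addn; rewrite index_map; last exact: chain_state_inj.
by rewrite -{1}[i]add0n -(nth_iota 0 0 (n := k.+1)) ?index_uniq ?size_iota ?iota_uniq.
Qed.

Lemma mem_chain_state k i : (chain_state i \in states k) = (i <= k).
Proof.
rewrite mem_cat (negbTE (chain_state_fresh i)) orFb mem_map; last exact: chain_state_inj.
by rewrite mem_iota.
Qed.

Lemma num_base k s : s \in states 0 -> num k s = num 0 s.
Proof.
rewrite mem_cat /= inE => /orP[h|/eqP ->]; first by rewrite /num /states !index_cat h.
by rewrite !num_chain.
Qed.

Lemma states_mono k s : s \in states 0 -> s \in states k.
Proof.
rewrite mem_cat /= inE => /orP[h|/eqP ->]; first by rewrite mem_cat h.
by rewrite mem_chain_state.
Qed.

Lemma statesP k s : s \in states k ->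
  s \in states 0 \/ exists2 i, i < k & s = chain_state i.+1.
Proof.
rewrite mem_cat => /orP[h|/mapP[[|i]]]; first by left; rewrite mem_cat h.
  by move=> _ ->; left; rewrite mem_chain_state.
by rewrite mem_iota => hi ->; right; exists i.
Qed.

Lemma stray_mem s : s \in strays -> s \in states 0.
Proof. by move=> h; rewrite !mem_cat h. Qed.

Lemma clean_mem w q : clean_reach X (w, q) -> Clean w q \in states 0.
Proof.
move=> h; rewrite !mem_cat mem_clean_rest /= inE orbC -/start.
by case: eqP => //= _; rewrite (asboolT h) !orbT.
Qed.

Lemma states_clean k w q : Clean w q \in states k ->
  clean_reach X (w, q) \/ exists2 i, i < k & Clean w q = chain_state i.+1.
Proof.
case/statesP=> [|h]; last by right.
rewrite !mem_cat mem_clean_rest /= inE => /orP[/orP[|]|].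
- by rewrite /strays; case: md.
- by case/andP => _ /asboolP; left.
by move/eqP=> [-> ->]; left; apply: clean_start.
Qed.

Lemma stray_step_base s e s' :
  s \in states 0 -> stray_step md X s e = Some s' -> s' \in states 0 /\ e \in labels.
Proof.
have hl := valid_letters X_valid.
have lab b l : l <= L -> ((b, l) \in labels).
  by move=> h; rewrite (allpairs_f pair) // ?mem_iota //; case: b.
case: e => sg l; case: s => [[[sd rd]|f]|[[|b w] q]] hs /=.
- case emd: md => [m|//]; case: ifP => // _; case: ifP => [hlt [<-]|_].
    split; last by apply: lab; apply: ltnW.
    by apply: stray_mem; rewrite /strays emd; case: (_ || _); case: (_ || _).
  case: ifP => // /andP[/eqP -> _] [<-]; split; last exact: lab.
  by apply: stray_mem; rewrite /strays emd; case: ifP => _; case: (sd); case: (rd).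
- case: ifP => // /andP[_ hlt] [<-]; split; last by apply: lab; apply: ltnW.
  apply: stray_mem; move: hs; rewrite !mem_cat inE /= /strays.
  have -> : Back f \in clean_rest = false by apply/negP => /clean_rest_clean[].
  by rewrite orbF orbF; case: md => [m|] ; case: f => //; case: (_ == 1).
- have [hc|[i _ //]] := states_clean hs.
  case: ifP => // _; case: eqP => [-> [<-]|/eqP l1].
    split; last by apply: lab; rewrite /L; lia.
    by apply: stray_mem; rewrite /strays; case: md.
  case: ifP => // hlt; case E: (tr_next X q l) => [w' q'] [<-].
  split; last by apply: lab; apply: ltnW.
  apply: clean_mem; rewrite -E; apply: clean_recv hc _; exact/andP.
have [hc|[i //]] := states_clean hs.
have [[_ /= /andP[/andP[hb _] _] _] _] := clean_reach_valid hc.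
case: ifP => // _; case: eqP => [-> [<-]|_].
  by split; [apply: clean_mem; apply: clean_send hc|apply: lab; apply: ltnW].
case emd: md => [m|//]; case: ifP => // hlt [<-].
split; last by apply: lab; apply: ltnW.
by apply: stray_mem; rewrite /strays emd; case: (_ == 1).
Qed.

Lemma back_mem : Back true \in states 0.
Proof. by apply: stray_mem; rewrite /strays; case: md. Qed.

Lemma num_inj k s s' : s \in states k -> s' \in states k -> num k s = num k s' -> s = s'.
Proof. by move=> h1 h2 h; rewrite -(nth_index start h1) -/(num k s) h nth_index. Qed.

Lemma mem_wrong_trans p n t :
  reflect (exists2 l, 0 < l <= n & t = (p, (true, l), 2 - l)) (t \in wrong_trans p n).
Proof.
elim: n t => [|n IH] t /=.
  by apply: (iffP idP) => // -[l]; lia.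
rewrite in_cons; apply: (iffP orP) => [[/eqP ->|/IH[l hl ->]]|[l hl ->]].
- by exists n.+1; [lia|congr (_, _, _); lia].
- by exists l => //; lia.
case: (eqVneq l n.+1) => [->|hln]; first by left; apply/eqP; congr (_, _, _); lia.
by right; apply/IH; exists l => //; lia.
Qed.

Lemma mem_chain_trans k t :
  reflect (exists i e s', [/\ i < k, stray_step md X (chain_state i.+1) e = Some s' &
             t = (nbase + i.+1, e, num k s')])
          (t \in chain_trans k).
Proof.
have hl := valid_letters X_valid.
(* Lengthening the chain does not renumber the states already present. *)
have nS k' s : num k' s = num k'.+1 s \/ s \notin states k'.
  case hs: (s \in states k'); [left|by right].
  case/statesP: hs => [h|[i hi ->]]; first by rewrite !num_base.
  by rewrite !num_chain //; lia.
have n0 k' : md -> num k' (Stray true false) = 1.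
  by move=> hmd; rewrite num_base /num /states /strays; case: md hmd => //= m _.
have n1 k' : md -> num k' (Stray false false) = 0.
  by move=> hmd; rewrite num_base /num /states /strays; case: md hmd => //= m _.
have here i k' t' : i < k' -> reflect
   (exists e s', stray_step md X (chain_state i.+1) e = Some s' /\
                 t' = (nbase + i.+1, e, num k' s'))
   ((t' == (nbase + i.+1, (true, 0), nbase + i)) ||
    (t' \in wrong_trans (nbase + i.+1) nwrong)).
  move=> hi; apply: (iffP orP).
    case=> [/eqP ->|/mem_wrong_trans[l hl' ->]].
      exists (true, 0), (chain_state i); split=> //=.
      by rewrite num_chain // ltnW.
    move: hl'; rewrite /nwrong; case emd: md => [m|]; last by lia.
    move=> hl'; exists (true, l), (Stray (l == 1) false); split.
      by rewrite /= ifN ?ifT //; [rewrite /L in hl'; lia|lia].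
    congr (_, _, _); case: (eqVneq l 1) => [->|l1]; first by rewrite n0 ?emd.
    by rewrite n1 ?emd //; lia.
  move=> [[[] l] [s' []]] //=; case: eqP => [-> [<-] ->|/eqP l0].
    by left; rewrite -/(chain_state i) num_chain // ltnW.
  rewrite /nwrong; case emd: md => [m|//]; case: ifP => // hlt [<-] ->; right.
  apply/mem_wrong_trans; exists l; first by rewrite /L; lia.
  congr (_, _, _); case: (eqVneq l 1) => [->|l1]; first by rewrite n0 ?emd.
  by rewrite n1 ?emd //; lia.
have closed i e s' : stray_step md X (chain_state i.+1) e = Some s' -> s' \in states i.
  case: e => -[] l //=; case: eqP => [_ [<-]|_].
    by rewrite -/(chain_state i) mem_chain_state.
  case emd: md => [m|//]; case: ifP => // _ [<-]; apply: states_mono.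
  by apply: stray_mem; rewrite /strays emd; case: (_ == 1).
elim: k t => [|k IH] t /=; first by apply: (iffP idP) => // -[i [e [s1 []]]].
rewrite in_cons mem_cat orbA; apply: (iffP orP).
  case=> [/(here k k.+1 _ (ltnSn k))[e [s' [h ->]]]|/IH[i [e [s' [h1 h2 ->]]]]].
    by exists k, e, s'.
  exists i, e, s'; split=> //; first by lia.
  case: (nS k s') => [-> //|/negP[]].
  have := closed _ _ _ h2 => /statesP[/states_mono -> //|[j hj ->]].
  by rewrite mem_chain_state; lia.
move=> [i [e [s' [hi h ->]]]]; case: (eqVneq i k) => [eik|nik].
  by left; apply/(here k k.+1 _ (ltnSn k)); exists e, s'; rewrite -eik.
right; apply/IH; exists i, e, s'; split=> //; first by lia.
case: (nS k s') => [-> //|/negP[]].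
have := closed _ _ _ h => /statesP[/states_mono -> //|[j hj ->]].
by rewrite mem_chain_state; lia.
Qed.

(** The transition list was laid out for the sake of its code; this identifies it with the graph of
    [tr_step], on which all later arguments rest. *)
Lemma mem_trans k p e q :
  (p, e, q) \in m_trans (tr_machine k) <->
  exists s s', [/\ s \in states k, tr_step md X (chain_state k) s e = Some s',
                   p = num k s & q = num k s'].
Proof.
rewrite /m_trans /= in_cons mem_cat; split.
  case/or3P => [/eqP[-> -> ->]|/mem_chain_trans[i [e' [s' [hi h [-> -> ->]]]]]|].
  - exists (Back true), (chain_state k); split; first exact/states_mono/back_mem.
    + by rewrite /tr_step !eqxx.
    + by rewrite num_base // back_mem.
    + by rewrite num_chain.
  - exists (chain_state i.+1), s'; split; rewrite ?mem_chain_state //.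
    by rewrite num_chain.
  rewrite mem_pmap => /mapP[[s e'] /allpairsP[[s1 e1] /= [h1 h2 [-> ->]]]].
  case E: (stray_step md X s1 e1) => [s'|//] [-> -> ->].
  have [h3 _] := stray_step_base h1 E.
  exists s1, s'; split; first exact: states_mono.
  - rewrite /tr_step; case: andP => // -[/eqP es /eqP ee].
    by move: E; rewrite es ee /= ltnn andbF.
  - by rewrite num_base.
  - by rewrite num_base.
move=> [s [s' [hs hn -> ->]]]; move: hn; rewrite /tr_step.
case: andP => [[/eqP -> /eqP ->] [<-]|_ hn].
  by rewrite num_base ?back_mem // num_chain // eqxx.
case/statesP: (hs) => [h0|[i hi es]]; last first.
  apply/or3P/Or32/mem_chain_trans; exists i, e, s'; rewrite -es; split=> //.
  by rewrite es num_chain.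
have [h1 h2] := stray_step_base h0 hn.
apply/or3P/Or33; rewrite mem_pmap; apply/mapP; exists (s, e).
  exact: (allpairs_f (fun s e => (s, e))).
by rewrite /= hn !num_base.
Qed.

Lemma tr_step_states k s e s' : s \in states k ->
  tr_step md X (chain_state k) s e = Some s' -> s' \in states k.
Proof.
move=> hs; rewrite /tr_step; case: ifP => [_ [<-]|_ hn]; first by rewrite mem_chain_state.
case/statesP: (hs) => [h0|[i hi es]]; first by have [/states_mono] := stray_step_base h0 hn.
move: hn; rewrite es; case: e => -[] l //=; case: eqP => [_ [<-]|_].
  by rewrite -/(chain_state i) mem_chain_state; apply: ltnW.
case emd: md => [m|//]; case: ifP => // _ [<-]; apply: states_mono.
by apply: stray_mem; rewrite /strays emd; case: (_ == 1).
Qed.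

Lemma arun_states k s w s' : s \in states k ->
  arun md X (chain_state k) s w = Some s' -> s' \in states k.
Proof.
elim: w s => [|e w IH] s hs /=; first by case=> <-.
by case E: tr_step => [s1|//]; apply: IH; apply: tr_step_states hs E.
Qed.

Lemma mpath_arun k s w s' : s \in states k ->
  arun md X (chain_state k) s w = Some s' -> mpath (tr_machine k) (num k s) w (num k s').
Proof.
elim: w s => [|e w IH] s hs /=; first by case=> <-; apply: mpath_nil.
case E: tr_step => [s1|//] h; apply: (@mpath_cons _ _ _ (num k s1)).
  by apply/mem_trans; exists s, s1.
by apply: IH h; apply: tr_step_states hs E.
Qed.

Lemma arun_mpath k s w q : s \in states k -> mpath (tr_machine k) (num k s) w q ->
  exists2 s', arun md X (chain_state k) s w = Some s' & q = num k s'.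
Proof.
move=> hs; move ep: (num k s) => p h.
elim: h s hs ep => {p w q} [p|p e q w r ht _ IH] s hs ep; first by exists s.
case/mem_trans: ht => s1 [s2 [h1 h2 e1 e2]].
have es : s = s1 by apply: (num_inj hs h1); rewrite ep.
by rewrite es /= h2; apply: IH => //; apply: tr_step_states h1 h2.
Qed.

Lemma num_lt k s : s \in states k -> num k s < m_nstates (tr_machine k).
Proof. by rewrite -index_mem size_states. Qed.

Lemma lt_num k p : p < m_nstates (tr_machine k) -> exists2 s, s \in states k & p = num k s.
Proof.
rewrite /m_nstates /= -size_states => hp; exists (nth start (states k) p); first exact: mem_nth.
by rewrite /num index_uniq // uniq_states.
Qed.

End Machine.

Definition tr_protocol (md : mode) (X0 X1 : transducer) (k : nat) : protocol :=
  ((tr_letters X0).+1, (tr_letters X0).+1, tr_machine md X0 k, tr_machine md X1 0).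

Lemma pickle_chain_trans md X k s :
  pickle (chain_trans md X k ++ s) =
  code_chain (nbase md X) (nwrong md X) (pickle s) k.
Proof.
have hw p n t : pickle (wrong_trans p n ++ t) = code_wrong n p (pickle t).
  by elim: n => //= n IH; rewrite /code_wrong /= -/(code_wrong n p _) -IH.
elim: k => //= k IH; rewrite -catA.
rewrite /code_chain /= -/(code_chain _ _ _ k) -IH -addnS -hw.
by [].
Qed.

(** The chain precedes the base transitions in the list, so its code is built on top of a fixed
    number, and no parameter on the right depends on [k]. *)
Lemma pickle_tr_protocol md X0 X1 k :
  pickle (tr_protocol md X0 X1 k) =
  code_protocol (pickle ((tr_letters X0).+1, (tr_letters X0).+1))
    (nbase md X0) (nwrong md X0) (pickle (num md X0 0 (Back true), home_label md X0))
    (pickle (base_trans md X0)) (pickle (tr_machine md X1 0)) k.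
Proof. by rewrite /code_protocol -pickle_chain_trans. Qed.

(** * The SR property and the absence of send cycles *)

Section Structure.
Variables (md : mode) (X : transducer) (k : nat).
Hypothesis X_valid : valid X.

Let L := tr_letters X.
Local Notation home := (chain_state X k).
Local Notation nxt := (tr_step md X home).
Local Notation run := (arun md X home).
Local Notation S := (states md X k).

Definition sends (s : state) : bool :=
  match s with
  | inl (inl _) => if md is Some m then m else true
  | inl (inr _) => back_sign md
  | inr (w, _) => w != [::]
  end.

Lemma tr_step_sends s e s' : nxt s e = Some s' -> e.1 = sends s.
Proof.
rewrite /tr_step; case: andP => [[/eqP -> /eqP ->] //|_].
case: e => sg l; case: s => [[[sd rd]|f]|[[|b w] q]] /=.
- by case: md => // m; case: eqP.
- by case: eqP.
- by case: sg.
- by case: sg.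
Qed.

Lemma tr_step_letter s e s' : s \in S -> nxt s e = Some s' -> e.2 <= L.
Proof.
have hl := valid_letters X_valid.
move=> hs; rewrite /tr_step; case: andP => [[_ /eqP ->] //|_].
case/(statesP X_valid): hs => [h0 h|[i hi ->]].
  have [_ /allpairsP[[b l] [_ h2 ->]]] := stray_step_base X_valid h0 h.
  by rewrite mem_iota in h2.
case: e => -[] l //=; case: eqP => [-> //|_].
by case: md => // m; case: ifP => // /ltnW.
Qed.

Definition conn (s s' : state) : Prop := exists w, run s w = Some s'.

Lemma arun_cat s w1 w2 :
  run s (w1 ++ w2) = if run s w1 is Some s1 then run s1 w2 else None.
Proof. by elim: w1 s => //= e w1 IH s; case: nxt. Qed.

Lemma conn_refl s : conn s s. Proof. by exists [::]. Qed.

Lemma conn_trans s2 s1 s3 : conn s1 s2 -> conn s2 s3 -> conn s1 s3.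
Proof. by move=> [w1 h1] [w2 h2]; exists (w1 ++ w2); rewrite arun_cat h1. Qed.

Lemma conn_step e s s' : nxt s e = Some s' -> conn s s'.
Proof. by move=> h; exists [:: e]; rewrite /= h. Qed.

Lemma conn_back f : conn (Back f) home.
Proof.
have hl := valid_letters X_valid.
apply: (@conn_trans (Back true)).
  apply: (@conn_step (back_sign md, 1)); rewrite /tr_step ifN; last first.
    by apply/negP => /andP[_ /eqP[]]; lia.
  by rewrite /= eqxx /= ifT ?orbT //; lia.
by apply: (@conn_step (back_sign md, L)); rewrite /tr_step !eqxx.
Qed.

Lemma conn_stray sd rd : md -> conn (Stray sd rd) home.
Proof.
have hl := valid_letters X_valid.
case emd: md => [m|//] _.
apply: (@conn_trans (Stray (sd || m) (rd || ~~ m))).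
  apply: (@conn_step (m, 1)); rewrite /tr_step /= emd /= eqxx ifT ?andbT //=; lia.
apply: (@conn_trans (Back (if m then rd || ~~ m else sd || m))); last exact: conn_back.
apply: (@conn_step (m, L)); rewrite /tr_step /= emd /= !eqxx /= ltnn.
by case: (m); rewrite /= orbT.
Qed.

Lemma conn_clean_nil w q : conn (Clean w q) (Clean [::] q).
Proof.
elim: w => [|b w IH]; first exact: conn_refl.
by apply: conn_trans IH; apply: (@conn_step (true, b)); rewrite /tr_step /= eqxx.
Qed.

Lemma conn_recv_stray q :
  conn (Clean [::] q) (if md is Some _ then Stray false true else Back true).
Proof. exact: (@conn_step (false, 1)). Qed.

(** A clean machine can send what is pending and receive the stray letter; a stray one can supply
    the missing stray letters and pass its end markers. *)
Lemma conn_home s : s \in S -> conn s home.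
Proof.
case: s => [[[sd rd]|f]|[w q]] hs.
- case emd: md => [m|]; first by apply: conn_stray; rewrite emd.
  case/(statesP X_valid): hs => [|[i //]].
  rewrite !mem_cat inE /= orbF /strays emd /= => h.
  by have [] := clean_rest_clean h.
- exact: conn_back.
apply: conn_trans (conn_clean_nil w q) _; apply: conn_trans (conn_recv_stray q) _.
by case emd: md => [m|]; [apply: conn_stray; rewrite emd|apply: conn_back].
Qed.

Lemma home_conn_chain i : i <= k -> conn home (chain_state X i).
Proof.
move=> hi; have -> : i = k - (k - i) by lia.
elim: (k - i) => [|j IH]; first by rewrite subn0; apply: conn_refl.
case: (leqP k j) => hj; first by have -> : k - j.+1 = k - j by lia.
apply: conn_trans IH _; have -> : k - j = (k - j.+1).+1 by lia.
exact: (@conn_step (true, 0)).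
Qed.

Lemma home_conn_clean c : clean_reach X c -> conn home (inr c).
Proof.
elim=> [|b w q _ IH|q l _ IH gl].
- exact: (@home_conn_chain 0).
- by apply: conn_trans IH (conn_step (e := (true, b)) _); rewrite /tr_step /= eqxx.
apply: conn_trans IH (conn_step (e := (false, l)) _); rewrite /tr_step /=.
by case/andP: gl => -> /negbTE ->.
Qed.

Lemma clean_nil_init : clean_reach X ([::], tr_init X).
Proof.
suff h w : clean_reach X (w, tr_init X) -> clean_reach X ([::], tr_init X).
  exact: (h (tr_word X) (clean_start X)).
by elim: w => // b w IH /clean_send.
Qed.

(** After receiving 0 in the initial control state the word [[:: 0]] is pending, and sending 2 or 1
    instead gives the first two stray states. Receiving 1 gives [Stray false true], and the others
    follow from these. *)
Lemma home_conn_stray s : s \in strays md -> conn home s.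
Proof.
have hl := valid_letters X_valid.
have h0 := home_conn_clean clean_nil_init.
have h1 := conn_trans h0 (conn_recv_stray _).
rewrite /strays; move: h1; case emd: md => [m|] h1; last by rewrite inE => /eqP ->.
have h2 : conn home (Clean [:: 0] (tr_next X (tr_init X) 0).2).
  have e0 : tr_next X (tr_init X) 0 = ([:: 0], (tr_next X (tr_init X) 0).2).
    by rewrite {1}[tr_next _ _ _]surjective_pairing (valid_echo X_valid).
  rewrite -e0; apply: home_conn_clean; apply: clean_recv clean_nil_init _.
  by apply/andP; split=> //; lia.
have h3 : conn home (Stray false false).
  by apply: conn_trans h2 (conn_step (e := (true, 2)) _); rewrite /tr_step /= emd ifT.
have h4 : conn home (Stray true false).
  by apply: conn_trans h2 (conn_step (e := (true, 1)) _); rewrite /tr_step /= emd ifT //; lia.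
have h5 : conn home (Stray true true).
  case em: m.
    apply: conn_trans h1 (conn_step (e := (true, 1)) _).
    by rewrite /tr_step /= emd em /= ifT //; lia.
  apply: conn_trans h4 (conn_step (e := (false, 1)) _).
  by rewrite /tr_step /= emd em /= ifT //; lia.
have h6 : conn home (Back false).
  case em: m.
    apply: conn_trans h4 (conn_step (e := (true, L)) _).
    by rewrite /tr_step /= emd em /= ltnn eqxx.
  apply: conn_trans h1 (conn_step (e := (false, L)) _).
  by rewrite /tr_step /= emd em /= ltnn eqxx.
have h7 : conn home (Back true).
  apply: conn_trans h6 (conn_step (e := (back_sign md, 1)) _).
  by rewrite /tr_step /= eqxx ifT //=; lia.
by rewrite !inE => /or4P[/eqP ->|/eqP ->|/eqP ->|/or3P[/eqP ->|/eqP ->|/eqP ->]].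
Qed.

Lemma home_conn s : s \in S -> conn home s.
Proof.
move=> /(statesP X_valid)[|[i hi ->]]; last exact: home_conn_chain.
rewrite !mem_cat inE => /orP[/orP[|]|/eqP ->].
- exact: home_conn_stray.
- by move=> h; have [c -> [hc _]] := clean_rest_clean h; apply: home_conn_clean.
exact: home_conn_chain.
Qed.

Lemma tr_machine_SR P j : p_mach P j = tr_machine md X k ->
  p_ka P = L.+1 -> p_kb P = L.+1 -> SR_machine P j.
Proof.
move=> eF ea eb; rewrite /SR_machine /wf_machine eF.
have hhome : home \in S by rewrite (mem_chain_state md X_valid).
split.
- split; first by rewrite /m_init /m_nstates /=.
  move=> p e q /(mem_trans md X_valid)[s [s' [hs hn -> ->]]].
  split; first exact: num_lt.
    by apply: num_lt => //; apply: tr_step_states hs hn.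
  have := tr_step_letter hs hn; case: e {hn} => sg l /=.
  by rewrite ea eb ltnS; case: ifP.
- move=> p /(lt_num X_valid)[s hs ->]; case E: (sends s); [left|right];
    move=> e q /(mem_trans md X_valid)[s1 [s2 [h1 h2 h3 h4]]];
    by rewrite (tr_step_sends h2) -(num_inj hs h1 h3).
- move=> p q /(lt_num X_valid)[s hs ->] /(lt_num X_valid)[s' hs' ->].
  have [w hw] := conn_trans (conn_home hs) (home_conn hs').
  by exists w; apply: mpath_arun.
move=> p e q1 q2 /(mem_trans md X_valid)[s [s1 [h1 h2 -> ->]]].
case/(mem_trans md X_valid)=> [s' [s2 [h3 h4 h5 ->]]].
by move: h4; rewrite -(num_inj h1 h3 h5) h2 => -[->].
Qed.

Lemma tr_machine_no_send_cycle : md = None -> ~ has_send_cycle (tr_machine md X k).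
Proof.
move=> emd [p [w [nz [ha hp]]]].
have [s hs ep] : exists2 s, s \in S & p = num md X k s.
  case: w {ha} nz hp => // e w _; move: {2}p => q hp; inversion hp as [|? ? ? ? ? ht].
  by case/(mem_trans md X_valid): ht => s [s' [hs _ -> _]]; exists s.
rewrite ep in hp; have [s' hr /(num_inj hs)es] := arun_mpath X_valid hs hp.
have {}es := es (arun_states X_valid hs hr); rewrite -{s'}es in hr.
(* In mode [None] only clean states send, and each send shortens the pending word. *)
pose rank (s : state) := if s is inr (w, _) then size w else 0.
have key s1 s2 v : all (fun e : label => e.1) v -> run s1 v = Some s2 ->
    rank s2 + size v <= rank s1.
  elim: v s1 => [|[sg l] v IH] s1 /=; first by move=> _ [->]; rewrite addn0.
  move=> /andP[hsg hv]; case E: nxt => [s3|//] /(IH _ hv) h.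
  apply: leq_trans (_ : (rank s3).+1 <= _); first by rewrite addnS.
  move: E; rewrite /tr_step hsg emd /= xpair_eqE andbF.
  case: s1 => [[[sd rd]|f]|[[|b u] q]] //=.
  by case: eqP => // _ [<-].
by have := key _ _ _ ha hr; case: (w) nz => //= ? ? _; lia.
Qed.

End Structure.

(** * Affinity *)

Inductive rounds (L : nat) : seq nat -> seq nat -> Prop :=
| rounds_nil : rounds L [::] [::]
| rounds_cons u v O I : all (ltn^~ L) u -> all (ltn^~ L) v -> 1 \in u -> 1 \in v ->
    rounds L O I -> rounds L (u ++ L :: O) (v ++ L :: I).

(** Both machines loop exactly along [rounds], but one sends what the other receives; this symmetry
    is what makes the pair affine. *)
Lemma rounds_sym L O I : rounds L O I -> rounds L I O.
Proof. by elim=> *; [apply: rounds_nil|apply: rounds_cons]. Qed.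

Definition outs (w : seq label) : seq nat := [seq e.2 | e <- w & e.1].
Definition ins (w : seq label) : seq nat := [seq e.2 | e <- w & ~~ e.1].

Section Affine.
Variables (m : bool) (X : transducer) (k : nat).
Hypothesis X_valid : valid X.

Let L := tr_letters X.
Local Notation md := (Some m).
Local Notation home := (chain_state X k).
Local Notation nxt := (tr_step md X home).
Local Notation run := (arun md X home).
Local Notation S := (states md X k).

Definition flagged (f : bool) (u : seq nat) : Prop :=
  all (ltn^~ L) u /\ f || (1 \in u).

(** The pairs of sent and received words that lead from [s] to [home], apart from the empty path at
    [home]. Under [two] both directions still owe the end marker of the current round; a flag tells
    that the stray letter of its direction has already occurred. *)
Definition lang (s : state) (O I : seq nat) : Prop :=
  let two sd rd := exists u v O' I', [/\ O = u ++ L :: O', I = v ++ L :: I',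
    rounds L O' I', flagged sd u & flagged rd v] in
  match s with
  | inl (inl (sd, rd)) => two sd rd
  | inl (inr f) =>
      if m then exists v I', [/\ I = v ++ L :: I', rounds L O I' & flagged f v]
      else exists u O', [/\ O = u ++ L :: O', rounds L O' I & flagged f u]
  | inr _ => two false false
  end.

Lemma lang_clean c O I : lang (inr c) O I -> rounds L O I.
Proof.
by move=> [u [v [O' [I' [-> -> h [hu1 hu2] [hv1 hv2]]]]]]; apply: rounds_cons.
Qed.

Lemma flagged_cons f l u : l < L -> flagged (f || (l == 1)) u -> flagged f (l :: u).
Proof.
move=> hl [h1 h2]; split; first by rewrite /= hl.
by rewrite in_cons eq_sym orbA.
Qed.

Lemma flagged_behead f l u : flagged f (l :: u) ->
  l < L /\ flagged (f || (l == 1)) u.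
Proof.
move=> [/= /andP[h1 h2] h3]; split=> //; split=> //.
by move: h3; rewrite in_cons eq_sym orbA.
Qed.

(** Thus [home] is re-entered by an end marker only, and every nonempty loop consists of complete
    rounds. *)
Lemma clean_step_home w q e c : Clean w q \in S ->
  stray_step md X (Clean w q) e = Some (inr c) -> (inr c : state) <> home.
Proof.
case: e => sg l hs; case: w hs => [|b w] hs /=.
  case: sg => //; case: eqP => // /eqP l1; case: ifP => // hl [<-].
  have [hc|[i //]] := states_clean X_valid hs.
  have [[_ _ hq] _] := clean_reach_valid X_valid hc.
  have gl : good X l by apply/andP.
  have [_ _ _ /eqP h] := valid_next X_valid hq gl.
  by case E: (tr_next X q l) h => [w' q'] /= h [_ /h].
case: sg => //=; case: eqP => [_ [<-] [ew eq]|_]; last by case: ifP.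
have [hc|[i hi [_ ew' _]]] := states_clean X_valid hs.
  have [_ /(_ eq)] := clean_reach_valid X_valid hc.
  by rewrite ew /= size_cat; lia.
by move: ew'; rewrite ew => /(congr1 size); rewrite !size_cat !size_nseq; lia.
Qed.

Lemma clean_letter b w q : Clean (b :: w) q \in S -> b < L /\ b != 1.
Proof.
move=> hs; have [hc|[i hi [-> _]]] := states_clean X_valid hs.
  by have [[_ /= /andP[/andP[]]]] := clean_reach_valid X_valid hc.
by have := valid_letters X_valid; rewrite /L; lia.
Qed.

Lemma arun_home_lang s w : s \in S -> run s w = Some home ->
  (w = [::] /\ s = home) \/ lang s (outs w) (ins w).
Proof.
elim: w s => [|[sg l] w IH] s hs /=; first by case=> ->; left.
case E: nxt => [s1|//] hr; right.
have hs1 := tr_step_states X_valid hs E.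
have {IH} := IH _ hs1 hr; move: E; rewrite /tr_step.
case: andP => [[/eqP -> /eqP[-> ->]] [<-] h|_ E].
  have hz : rounds L (outs w) (ins w).
    by case: h => [[-> _]|/lang_clean //]; apply: rounds_nil.
  by rewrite /outs /ins /=; case: (m) => /=; [exists [::], (ins w)|exists [::], (outs w)].
have nh c : s = inr c -> s1 <> home.
  case: s1 E {hs1 hr} => [//|c1] E es; case: c es => w' q es.
  by rewrite es in E hs; apply: clean_step_home E.
case=> [[_ es1]|].
  case: s hs E nh => [[[sd rd]|f]|[v q]] hs E nh; last by have := nh _ erefl es1.
    move: E; rewrite es1 /=; case: ifP => // _; case: ifP => // _.
    by case: ifP.
  by move: E; rewrite es1 /=; case: ifP.
case: s hs E {nh} => [[[sd rd]|f]|[[|b v] q]] hs /=.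
- case: eqP => //= -> {sg}; case: ifP => [hl [<-]|hl].
    move=> [u [v [O [I [eO eI hz fu fv]]]]]; rewrite /outs /ins /=.
    case: (m) fu fv => /=; rewrite ?orbF => fu fv.
      exists (l :: u), v, O, I; split=> //; first by rewrite /= -eO.
      exact: flagged_cons.
    exists u, (l :: v), O, I; split=> //; first by rewrite /= -eI.
    exact: flagged_cons.
  case: ifP => // /andP[/eqP -> hf] [<-]; rewrite /outs /ins /=.
  case: (m) hf => /= hf.
    move=> [v [I [eI hz fv]]]; exists [::], v, (outs w), I; split=> //.
    by split=> //; rewrite hf.
  move=> [u [O [eO hz fu]]]; exists u, [::], O, (ins w); split=> //.
  by split=> //; rewrite hf.
- case: ifP => // /andP[/eqP -> hl] [<-]; rewrite /outs /ins /=; case: (m) => /=.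
    move=> [v [I [eI hz fv]]]; exists (l :: v), I; split=> //; first by rewrite /= -eI.
    exact: flagged_cons.
  move=> [u [O [eO hz fu]]]; exists (l :: u), O; split=> //; first by rewrite /= -eO.
  exact: flagged_cons.
- have hL := valid_letters X_valid.
  case: sg => //; case: eqP => [->|/eqP l1].
    move=> [<-] [u [v [O [I [eO eI hz fu fv]]]]]; rewrite /outs /ins /=.
    exists u, (1 :: v), O, I; split=> //; first by rewrite /= -eI.
    by apply: flagged_cons => //; rewrite /L; lia.
  case: ifP => // hl [<-] [u [v [O [I [eO eI hz fu fv]]]]]; rewrite /outs /ins /=.
  exists u, (l :: v), O, I; split=> //; first by rewrite /= -eI.
  by apply: flagged_cons => //; rewrite (negbTE l1).
have [hb b1] := clean_letter hs.
case: sg => //=; case: eqP => [->|_].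
  move=> [<-] [u [v' [O [I [eO eI hz fu fv]]]]]; rewrite /outs /ins /=.
  exists (b :: u), v', O, I; split=> //; first by rewrite /= -eO.
  by apply: flagged_cons => //; rewrite (negbTE b1).
case: ifP => // hl [<-] [u [v' [O [I [eO eI hz fu fv]]]]]; rewrite /outs /ins /=.
exists (l :: u), v', O, I; split=> //; first by rewrite /= -eO.
exact: flagged_cons.
Qed.

(** The state determines whether to send or to receive, and the next letter of the corresponding
    word is always accepted, so the path is built greedily. A clean state never meets an end marker,
    because the stray letter must come first. *)
Lemma lang_arun n O I : size O + size I <= n ->
  (forall s, s \in S -> lang s O I ->
     exists w, [/\ run s w = Some home, outs w = O & ins w = I]) /\
  (rounds L O I -> exists w, [/\ run home w = Some home, outs w = O & ins w = I]).
Proof.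
have hL := valid_letters X_valid.
have hhome : home \in S by rewrite (mem_chain_state md X_valid).
elim: n O I => [|n IH] O I hn.
  case: O I hn => [|? ?] [|? ?] // _; split; last by exists [::].
  case=> [[[sd rd]|f]|c] _ /=.
  - by move=> [[|? ?] [? [? [? []]]]].
  - by case: (m) => -[[|? ?] [? []]].
  - by move=> [[|? ?] [? [? [? []]]]].
have step s e s1 O' I' : s \in S -> nxt s e = Some s1 ->
    size O' + size I' <= n -> lang s1 O' I' \/ (s1 = home /\ rounds L O' I') ->
    O = (if e.1 then e.2 :: O' else O') -> I = (if e.1 then I' else e.2 :: I') ->
    exists w, [/\ run s w = Some home, outs w = O & ins w = I].
  move=> hs hn1 hsz hl eO eI; have [IH1 IH2] := IH O' I' hsz.
  have [w [h1 h2 h3]] : exists w, [/\ run s1 w = Some home, outs w = O' & ins w = I'].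
    by case: hl => [/(IH1 _ (tr_step_states X_valid hs hn1)) //|[-> /IH2]].
  exists (e :: w); rewrite /= hn1 h1 /outs /ins eO eI /=.
  by case: (e.1) => /=; rewrite -h2 -h3.
suff h s : s \in S -> lang s O I ->
    exists w, [/\ run s w = Some home, outs w = O & ins w = I].
  split=> // hr.
  have [[-> ->]|h'] : (O = [::] /\ I = [::]) \/ lang home O I.
    case: hr => [|u v O' I' hu hv u1 v1 hz]; first by left.
    by right; exists u, v, O', I'.
    by exists [::].
  exact: h.
case: s => [[[sd rd]|f]|[[|b w] q]] hs.
- move=> /= [u [v [O' [I' [eO eI hz fu fv]]]]]; rewrite eO eI in hn.
  have [em|em] : m = true \/ m = false by case: (m); [left|right].
    case: u eO hn fu => [|l u] eO hn fu.
      apply: (@step _ (true, L) (Back rd) O' I) => //.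
      + by rewrite /tr_step /= em /= ltnn eqxx /=; case: fu => _; rewrite in_nil orbF => ->.
      + by rewrite eI; move: hn; rewrite !size_cat /=; lia.
      + by left; rewrite /= em; exists v, I'.
    have [hl fu'] := flagged_behead fu.
    apply: (@step _ (true, l) (Stray (sd || (l == 1)) rd) (u ++ L :: O') I) => //.
    + by rewrite /tr_step /= em /= hl orbF.
    + by rewrite eI; move: hn; rewrite !size_cat /=; lia.
    + by left; exists u, v, O', I'.
  case: v eI hn fv => [|l v] eI hn fv.
    apply: (@step _ (false, L) (Back sd) O I') => //.
    + by rewrite /tr_step /= em /= ltnn eqxx /=; case: fv => _; rewrite in_nil orbF => ->.
    + by rewrite eO; move: hn; rewrite !size_cat /=; lia.
    + by left; rewrite /= em; exists u, O'.
  have [hl fv'] := flagged_behead fv.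
  apply: (@step _ (false, l) (Stray sd (rd || (l == 1))) O (v ++ L :: I')) => //.
  + by rewrite /tr_step /= em /= hl orbF.
  + by rewrite eO; move: hn; rewrite !size_cat /=; lia.
  + by left; exists u, v, O', I'.
- have [em|em] : m = true \/ m = false by case: (m); [left|right].
    move=> hla; rewrite /= em in hla; have [v [I' [eI hz fv]]] := hla; rewrite eI in hn.
    case: v eI hn fv => [|l v] eI hn fv.
      apply: (@step _ (false, L) home O I') => //.
      + by case: fv => _; rewrite in_nil orbF => ->; rewrite /tr_step /= em !eqxx.
      + by move: hn => /=; lia.
      + by right.
    have [hl fv'] := flagged_behead fv.
    apply: (@step _ (false, l) (Back (f || (l == 1))) O (v ++ L :: I')) => //.
    + rewrite /tr_step ifN /= ?em /= ?hl //.
      apply/negP => /andP[_ /eqP[el]]; move: hl; by rewrite el ltnn.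
    + by move: hn; rewrite !size_cat /=; lia.
    + by left; rewrite /= em; exists v, I'.
  move=> hla; rewrite /= em in hla; have [u [O' [eO hz fu]]] := hla; rewrite eO in hn.
  case: u eO hn fu => [|l u] eO hn fu.
    apply: (@step _ (true, L) home O' I) => //.
    + by case: fu => _; rewrite in_nil orbF => ->; rewrite /tr_step /= em !eqxx.
    + by right.
  have [hl fu'] := flagged_behead fu.
  apply: (@step _ (true, l) (Back (f || (l == 1))) (u ++ L :: O') I) => //.
  + rewrite /tr_step ifN /= ?em /= ?hl //.
    apply/negP => /andP[_ /eqP[el]]; move: hl; by rewrite el ltnn.
  + by left; rewrite /= em; exists u, O'.
- move=> [u [v [O' [I' [eO eI hz fu fv]]]]]; rewrite eO eI in hn.
  case: v eI hn fv => [|l v] eI hn fv; first by case: fv.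
  have [hl fv'] := flagged_behead fv; case: (eqVneq l 1) => l1.
    apply: (@step _ (false, l) (Stray false true) O (v ++ L :: I')) => //.
    + by rewrite l1.
    + by rewrite eO; move: hn; rewrite !size_cat /=; lia.
    + by left; exists u, v, O', I'; split=> //; rewrite l1 in fv'.
  apply: (@step _ (false, l) (inr (tr_next X q l)) O (v ++ L :: I')) => //.
  + by rewrite /tr_step /= (negbTE l1) ifT.
  + by rewrite eO; move: hn; rewrite !size_cat /=; lia.
  + by left; exists u, v, O', I'; split=> //; rewrite (negbTE l1) in fv'.
move=> [u [v [O' [I' [eO eI hz fu fv]]]]]; rewrite eO eI in hn.
have [hb b1] := clean_letter hs.
case: u eO hn fu => [|l u] eO hn fu; first by case: fu.
have [hl fu'] := flagged_behead fu; case: (eqVneq l b) => lb.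
  apply: (@step _ (true, l) (Clean w q) (u ++ L :: O') I) => //.
  + by rewrite /tr_step /= lb eqxx.
  + by rewrite eI; move: hn; rewrite !size_cat /=; lia.
  + by left; exists u, v, O', I'; split=> //; rewrite lb (negbTE b1) in fu'.
apply: (@step _ (true, l) (Stray (l == 1) false) (u ++ L :: O') I) => //.
+ by rewrite /tr_step /= (negbTE lb) ifT.
+ by rewrite eI; move: hn; rewrite !size_cat /=; lia.
+ by left; exists u, v, O', I'.
Qed.

Lemma arun_home_rounds O I : rounds L O I <->
  exists w, [/\ run home w = Some home, outs w = O & ins w = I].
Proof.
split; first by case: (lang_arun (leqnn (size O + size I))).
have hhome : home \in S by rewrite (mem_chain_state md X_valid).
move=> [w [h <- <-]]; case: (arun_home_lang hhome h) => [[-> _]|/lang_clean //].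
exact: rounds_nil.
Qed.

Lemma tr_machine_loops w : mpath (tr_machine md X k) (nbase md X + k) w (nbase md X + k) <->
  run home w = Some home.
Proof.
have hhome : home \in S by rewrite (mem_chain_state md X_valid).
rewrite -(num_chain md X_valid (leqnn k)); split; last exact: mpath_arun.
move=> /(arun_mpath X_valid hhome)[s' h /(num_inj hhome) e].
by rewrite h -e // (arun_states X_valid hhome h).
Qed.

End Affine.

Lemma tr_protocol_affine m X0 X1 k : valid X0 -> valid X1 ->
  tr_letters X1 = tr_letters X0 -> affine (tr_protocol (Some m) X0 X1 k).
Proof.
move=> v0 v1 eL [x y].
have e0 w : (pi_alpha false w, pi_beta false w) = (outs w, ins w).
  by congr (_, _); congr map; apply: eq_filter => -[[] l].
(* For machine 1 the channel [alpha] carries the input, hence the exchanged order. *)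
have e1 w : (pi_alpha true w, pi_beta true w) = (ins w, outs w).
  by congr (_, _); congr map; apply: eq_filter => -[[] l].
have z0 : Zset (tr_protocol (Some m) X0 X1 k) false (x, y) <-> rounds (tr_letters X0) x y.
  rewrite (arun_home_rounds m k v0 x y); split=> -[w].
    by rewrite e0 => -[/(tr_machine_loops _ _ v0) h [-> ->]]; exists w.
  by move=> [/(tr_machine_loops _ _ v0) h <- <-]; exists w; rewrite e0.
have z1 : Zset (tr_protocol (Some m) X0 X1 k) true (x, y) <-> rounds (tr_letters X1) y x.
  rewrite (arun_home_rounds m 0 v1 y x); split=> -[w].
    by rewrite e1 => -[/(tr_machine_loops _ _ v1) h [-> ->]]; exists w.
  by move=> [/(tr_machine_loops _ _ v1) h <- <-]; exists w; rewrite e1.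
by rewrite z0 z1 eL; split; apply: rounds_sym.
Qed.

Lemma tr_protocol_SR md X0 X1 k : valid X0 -> valid X1 ->
  tr_letters X1 = tr_letters X0 -> SR_pair (tr_protocol md X0 X1 k).
Proof.
by move=> v0 v1 eL; split; [apply: (tr_machine_SR v0)|apply: (tr_machine_SR v1)]; rewrite ?eL.
Qed.

Lemma tr_protocol_no_send_cycles X0 X1 k : valid X0 -> valid X1 ->
  no_send_cycles (tr_protocol None X0 X1 k).
Proof. by move=> v0 v1; split; apply: tr_machine_no_send_cycle. Qed.

(** * Runs of a completed transducer pair *)

(* One machine's view: its state, its output channel and its input channel. *)
Inductive hstep (md : mode) (X : transducer) (home : state) :
  state -> seq nat -> seq nat -> state -> seq nat -> seq nat -> Prop :=
| hstep_send s s' b x y : tr_step md X home s (true, b) = Some s' ->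
    hstep md X home s x y s' (rcons x b) y
| hstep_recv s s' b x y : tr_step md X home s (false, b) = Some s' ->
    hstep md X home s x (b :: y) s' x y.

(** Reachability on described rather than numbered states. Both machines move by [hstep], with the
    channels exchanged for machine 1, so invariants can be proved for one side at a time. *)
Inductive areach (md : mode) (X0 X1 : transducer) (k : nat) :
  state -> state -> seq nat -> seq nat -> Prop :=
| areach_init : areach md X0 X1 k (chain_state X0 k) (chain_state X1 0) [::] [::]
| areach_step0 s0 s1 xa xb s0' xa' xb' : areach md X0 X1 k s0 s1 xa xb ->
    hstep md X0 (chain_state X0 k) s0 xa xb s0' xa' xb' ->
    areach md X0 X1 k s0' s1 xa' xb'
| areach_step1 s0 s1 xa xb s1' xa' xb' : areach md X0 X1 k s0 s1 xa xb ->
    hstep md X1 (chain_state X1 0) s1 xb xa s1' xb' xa' ->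
    areach md X0 X1 k s0 s1' xa' xb'.

Lemma hstep_states md X k s x y s' x' y' : valid X -> s \in states md X k ->
  hstep md X (chain_state X k) s x y s' x' y' -> s' \in states md X k.
Proof. by move=> vX hs h; case: h hs => *; apply: tr_step_states; eauto. Qed.

(** * Translation between numbered and described runs *)

Section Global.
Variables (md : mode) (X0 X1 : transducer) (k : nat).
Hypotheses (v0 : valid X0) (v1 : valid X1).

Local Notation P := (tr_protocol md X0 X1 k).

Lemma areach_states s0 s1 xa xb : areach md X0 X1 k s0 s1 xa xb ->
  s0 \in states md X0 k /\ s1 \in states md X1 0.
Proof.
elim=> [|? ? ? ? ? ? ? _ [h0 h1] h|? ? ? ? ? ? ? _ [h0 h1] h].
- by rewrite !mem_chain_state.
- by split=> //; apply: hstep_states h.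
- by split=> //; apply: hstep_states h.
Qed.

Definition emb (s0 s1 : state) (xa xb : seq nat) : gstate :=
  ((num md X0 k s0, num md X1 0 s1), (xa, xb)).

Lemma areach_reachable s0 s1 xa xb :
  areach md X0 X1 k s0 s1 xa xb -> reachable P (emb s0 s1 xa xb).
Proof.
elim=> [|t0 t1 ya yb t0' ya' yb' h IH hh|t0 t1 ya yb t1' ya' yb' h IH hh].
- rewrite /emb !num_chain //; exact: (reach_init P).
- have [h0 h1] := areach_states h; apply: reach_step IH _.
  case: hh h0 {h} => s s' b x y e h0; [apply: send0|apply: recv0];
  by apply/(mem_trans md v0); exists s, s'.
have [h0 h1] := areach_states h; apply: reach_step IH _.
case: hh h1 {h} => s s' b x y e h1; [apply: send1|apply: recv1];
by apply/(mem_trans md v1); exists s, s'.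
Qed.

Lemma reachable_areach g : reachable P g ->
  exists s0 s1 xa xb, areach md X0 X1 k s0 s1 xa xb /\ g = emb s0 s1 xa xb.
Proof.
elim=> [|{}g g' _ [s0 [s1 [xa [xb [h ->]]]]] hs].
  exists (chain_state X0 k), (chain_state X1 0), [::], [::].
  by split; [apply: areach_init|rewrite /emb !num_chain].
have [h0 h1] := areach_states h.
inversion hs as [p0 q0 p1 b ya yb ht e1 e2|p0 p1 q1 b ya yb ht e1 e2
                |p0 q0 p1 b ya yb ht e1 e2|p0 p1 q1 b ya yb ht e1 e2].
- case/(mem_trans md v0): ht => s [s' [h2 h3 /esym h4 ->]].
  move: h3; rewrite (num_inj h2 h0 _) ?h4 // => h3.
  exists s', s1, (rcons xa b), xb; split=> //; exact: areach_step0 h (hstep_send _ _ h3).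
- case/(mem_trans md v1): ht => s [s' [h2 h3 /esym h4 ->]].
  move: h3; rewrite (num_inj h2 h1 _) ?h4 // => h3.
  exists s0, s', xa, (rcons xb b); split=> //; exact: areach_step1 h (hstep_send _ _ h3).
- case/(mem_trans md v0): ht => s [s' [h2 h3 /esym h4 ->]].
  move: h3; rewrite (num_inj h2 h0 _) ?h4 // => h3.
  exists s', s1, xa, yb; split=> //; apply: areach_step0 h _.
  by rewrite -H1; apply: hstep_recv.
case/(mem_trans md v1): ht => s [s' [h2 h3 /esym h4 ->]].
move: h3; rewrite (num_inj h2 h1 _) ?h4 // => h3.
exists s0, s', ya, xb; split=> //; apply: areach_step1 h _.
by rewrite -H0; apply: hstep_recv.
Qed.

Lemma recv_state_num X j s : valid X -> s \in states md X j ->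
  recv_state (tr_machine md X j) (num md X j s) <-> sends md s = false.
Proof.
move=> vX hs; have hl := valid_letters vX; split; last first.
  move=> hf e q /(mem_trans md vX)[s1 [s2 [h1 h2 h3 h4]]].
  by rewrite (tr_step_sends h2) -(num_inj hs h1 h3).
(* A state without transitions would be a receive state vacuously, so every state must be shown to
   have one. *)
suff [e [s' h]] : exists e s', tr_step md X (chain_state X j) s e = Some s'.
  move=> /(_ e (num md X j s')); rewrite (tr_step_sends h); apply.
  by apply/mem_trans => //; exists s, s'.
case: s hs => [[[sd rd]|f]|[[|b w] q]] hs.
- case emd: md => [m|].
    exists (m, 0); eexists; rewrite /tr_step /= eqxx ifT //; lia.
  case/(statesP vX): hs => [|[i //]].
  rewrite !mem_cat inE /= orbF /strays emd /= => h.
  by have [] := clean_rest_clean h.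
- exists (back_sign md, 0); eexists; rewrite /tr_step ifN.
    by rewrite /= eqxx ifT //; lia.
  by apply/negP => /andP[_ /eqP[]]; lia.
- by exists (false, 1); eexists.
by exists (true, b); eexists; rewrite /tr_step /= eqxx.
Qed.

Lemma deadlock_freeP : deadlock_free P <->
  (forall s0 s1, areach md X0 X1 k s0 s1 [::] [::] -> sends md s0 || sends md s1).
Proof.
split=> [h s0 s1 hr|h g /reachable_areach[s0 [s1 [xa [xb [hr ->]]]]] [/= h1 h2 exa exb]].
  have [h0 h1] := areach_states hr; have := h _ (areach_reachable hr).
  case E0: (sends md s0) => //; case E1: (sends md s1) => // nd; case: nd.
  by split=> //; apply/recv_state_num.
rewrite exa exb in hr; have [m0 m1] := areach_states hr.
have := h _ _ hr; rewrite (recv_state_num v0 m0).1 // (recv_state_num v1 m1).1 //.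
Qed.

Lemma bounded_channelP : bounded_channel P <->
  exists B, forall s0 s1 xa xb, areach md X0 X1 k s0 s1 xa xb -> size xa + size xb <= B.
Proof.
split=> -[B h]; exists B; first by move=> s0 s1 xa xb /areach_reachable /h.
by move=> g /reachable_areach[s0 [s1 [xa [xb [/h hr ->]]]]].
Qed.

End Global.

(** * The echo machine and the two channels as one queue *)

(** A second control state is present because [valid] forbids returning to the initial one. *)
Definition echo (L : nat) : transducer := Transducer (fun _ l => ([:: l], 1)) 0 [::] 2 L.

Lemma echo_valid L : 2 < L -> valid (echo L).
Proof. by move=> hL; split=> //= q l _ hl; rewrite andbT. Qed.

(* The contents of both channels and both pending words, read in the order in
   which they will reach machine 0, form a single queue. *)
Inductive qreach (X : transducer) (k : nat) : nat -> seq nat -> Prop :=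
| qreach_init : qreach X k (tr_init X) (nseq k 0 ++ tr_word X)
| qreach_step q b r : qreach X k q (b :: r) ->
    qreach X k (tr_next X q b).2 (r ++ (tr_next X q b).1).

Section Queue.
Variables (md : mode) (X : transducer) (k : nat).
Hypothesis X_valid : valid X.

Let L := tr_letters X.
Local Notation E := (echo L).
Local Notation home := (chain_state X k).
Local Notation ehome := (chain_state E 0).

(** The front of the queue is what machine 0 receives next. Nothing is claimed once a machine has
    strayed. *)
Definition clean_inv (s0 s1 : state) (xa xb : seq nat) : Prop :=
  if s0 is inr (w0, q0) then
    if s1 is inr (w1, _) then qreach X k q0 (xb ++ w1 ++ xa ++ w0) else True
  else True.

Lemma qreach_good q u : qreach X k q u -> q < tr_size X /\ all (good X) u.
Proof.
have hl := valid_letters X_valid.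
elim=> [|{}q b r _ [hq /= /andP[hb hr]]].
  split; first exact: valid_init.
  rewrite all_cat (valid_word X_valid) andbT; apply/allP => x /nseqP[-> _].
  by apply/andP; split=> //; lia.
by have [_ h1 h2 _] := valid_next X_valid hq hb; rewrite all_cat hr.
Qed.

Lemma clean_inv_init : clean_inv home ehome [::] [::].
Proof. exact: qreach_init. Qed.

Lemma clean_stepE Y h w q e w' q' :
  tr_step md Y h (Clean w q) e = Some (Clean w' q') ->
  (e.1 /\ w = e.2 :: w' /\ q = q') \/
  (~~ e.1 /\ w = [::] /\ (w', q') = tr_next Y q e.2).
Proof.
rewrite /tr_step /=; case: e => sg l; case: w => [|b w] /=.
  case: sg => //; case: eqP => [_|_]; first by case: md.
  by case: ifP => // _ [->]; right.
case: sg => //=; case: eqP => [-> [-> ->]|_]; first by left.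
by case: md => // m; case: ifP.
Qed.

(** A send moves a letter within the queue. A receive happens with nothing pending, so a letter
    leaves at the front and the answer enters at the back. *)
Lemma clean_inv_step0 c0 c1 xa xb c0' xa' xb' :
  clean_inv (inr c0) (inr c1) xa xb ->
  hstep md X home (inr c0) xa xb (inr c0') xa' xb' ->
  clean_inv (inr c0') (inr c1) xa' xb'.
Proof.
case: c0 c0' c1 => w0 q0 [w0' q0'] [w1 q1] hc hh.
inversion hh as [? ? b ? ? e|? ? b ? ? e]; subst.
  case/clean_stepE: e hc => [[_ [-> <-]]|[//]] /=.
  by rewrite -cats1 -!catA.
case/clean_stepE: e hc => [[//]|[_ [-> /= e]]].
rewrite cats0 => /qreach_step; rewrite -e -!catA; exact.
Qed.

Lemma clean_inv_step1 c0 c1 xa xb c1' xa' xb' :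
  clean_inv (inr c0) (inr c1) xa xb ->
  hstep md E ehome (inr c1) xb xa (inr c1') xb' xa' ->
  clean_inv (inr c0) (inr c1') xa' xb'.
Proof.
case: c0 c1' c1 => w0 q0 [w1' q1'] [w1 q1] hc hh.
inversion hh as [? ? b ? ? e|? ? b ? ? e]; subst.
  case/clean_stepE: e hc => [[_ [-> <-]]|[//]] /=.
  by rewrite -cats1 -!catA.
by case/clean_stepE: e hc => [[//]|[_ [-> /= [-> _]]]].
Qed.

(** Each pending letter is sent, received by the echo and sent back at once. Hence any reachable
    queue can be realized entirely inside channel [beta]. *)
Lemma areach_drain w q q1 u : all (good X) w ->
  areach md X E k (Clean w q) (Clean [::] q1) [::] u ->
  exists q1', areach md X E k (Clean [::] q) (Clean [::] q1') [::] (u ++ w).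
Proof.
elim: w q1 u => [|b w IH] q1 u; first by rewrite cats0; exists q1.
move=> /= /andP[/andP[hb b1] hw] h.
have h1 : areach md X E k (Clean w q) (Clean [::] q1) [:: b] u.
  by apply: areach_step0 h (@hstep_send _ _ _ _ _ b [::] u _); rewrite /tr_step /= eqxx.
have h2 : areach md X E k (Clean w q) (Clean [:: b] 1) [::] u.
  apply: areach_step1 h1 (@hstep_recv _ _ _ _ _ b u [::] _).
  by rewrite /tr_step /= (negbTE b1) ifT.
have h3 : areach md X E k (Clean w q) (Clean [::] 1) [::] (rcons u b).
  by apply: areach_step1 h2 (@hstep_send _ _ _ _ _ b u [::] _); rewrite /tr_step /= eqxx.
by rewrite -cat_rcons; apply: IH hw h3.
Qed.

Lemma qreach_areach q u : qreach X k q u ->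
  exists q1, areach md X E k (Clean [::] q) (Clean [::] q1) [::] u.
Proof.
elim=> [|{}q b r hq [q1 h]].
  have [_ hg] := qreach_good (qreach_init X k).
  exact: (@areach_drain _ _ 0 [::] hg (areach_init _ _ _ _)).
have [hq' /= /andP[hb _]] := qreach_good hq.
have [_ hg _ _] := valid_next X_valid hq' hb.
apply: (@areach_drain _ _ q1 r hg); rewrite -surjective_pairing.
apply: areach_step0 h (@hstep_recv _ _ _ _ _ b [::] r _).
by rewrite /tr_step /=; case/andP: hb => -> /negbTE ->.
Qed.

Lemma qreach_deadlock q : 2 < L -> qreach X k q [::] ->
  ~ deadlock_free (tr_protocol md X E k).
Proof.
move=> hL /qreach_areach[q1 h] /(deadlock_freeP _ _ X_valid (echo_valid hL)).
by move=> /(_ _ _ h).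
Qed.

Lemma qreach_unbounded : 2 < L -> (forall N, exists q u, qreach X k q u /\ N <= size u) ->
  ~ bounded_channel (tr_protocol md X E k).
Proof.
move=> hL h /(bounded_channelP _ _ X_valid (echo_valid hL))[B hB].
have [q [u [/qreach_areach[q1 /hB /=] h1 h2]]] := h B.+1; lia.
Qed.

Lemma clean_inv_good c0 w1 q1 xa xb :
  clean_inv (inr c0) (inr (w1, q1)) xa xb -> all (good X) xa /\ all (good X) xb.
Proof.
by case: c0 => w0 q0 /qreach_good[_]; rewrite !all_cat => /and4P[].
Qed.

End Queue.

(** * Runs without strays *)

Section NoStray.
Variables (X : transducer) (k : nat).
Hypothesis X_valid : valid X.
Local Notation E := (echo (tr_letters X)).

(** In mode [None] wrong letters cannot be sent, so the stray letter never arrives and both machines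
    remain clean. *)
Lemma areach_none s0 s1 xa xb : areach None X E k s0 s1 xa xb ->
  exists c0 c1, [/\ s0 = inr c0, s1 = inr c1 & clean_inv X k s0 s1 xa xb].
Proof.
have stay Y h c s' x y x' y' : hstep None Y h (inr c) x y s' x' y' ->
    all (good X) y -> exists c', s' = inr c'.
  move=> hh; inversion hh as [? ? b ? ? e|? ? b ? ? e]; subst => hg; move: e.
    rewrite /tr_step /=; case: c {hh} => -[|a w] q //=.
    by case: eqP => // _ [<-]; eexists.
  rewrite /tr_step /=; case: c {hh} => -[|a w] q //=.
  case: eqP => [e|_]; first by move: hg; rewrite e /= /good andbF.
  by case: ifP => // _ [<-]; eexists.
elim=> [|t0 t1 ya yb t0' ya' yb' _ [[w0 q0] [[w1 q1] [-> -> hc]]] hh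
        |t0 t1 ya yb t1' ya' yb' _ [[w0 q0] [[w1 q1] [-> -> hc]]] hh].
- by do 2 eexists; split; [reflexivity|reflexivity|apply: clean_inv_init].
- have [ga gb] := clean_inv_good X_valid hc.
  have [c' e] := stay _ _ _ _ _ _ _ _ hh gb; rewrite e in hh *.
  by do 2 eexists; split; [reflexivity|reflexivity|apply: clean_inv_step0 hc hh].
have [ga gb] := clean_inv_good X_valid hc.
have [c' e] := stay _ _ _ _ _ _ _ _ hh ga; rewrite e in hh *.
by do 2 eexists; split; [reflexivity|reflexivity|apply: clean_inv_step1 hc hh].
Qed.

Lemma deadlock_free_none : (forall q, ~ qreach X k q [::]) ->
  deadlock_free (tr_protocol None X E k).
Proof.
move=> h; apply/(deadlock_freeP _ _ X_valid (echo_valid (valid_letters X_valid))).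
move=> s0 s1 /areach_none[[w0 q0] [[w1 q1] [-> -> /=]]].
by case: w0 w1 => [|? ?] [|? ?] //= /h.
Qed.

Lemma bounded_none N : (forall q u, qreach X k q u -> size u <= N) ->
  bounded_channel (tr_protocol None X E k).
Proof.
move=> h; apply/(bounded_channelP _ _ X_valid (echo_valid (valid_letters X_valid))).
exists N => s0 s1 xa xb /areach_none[[w0 q0] [[w1 q1] [-> -> /= /h]]].
by rewrite !size_cat; lia.
Qed.

End NoStray.

(** * Deadlock freedom when stray machines send first *)

Definition is_clean (s : state) : bool := if s is inr _ then true else false.

(** Here [x] is the output channel of the machine in state [s]. Its marker is the last letter sent
    before phase [Back], which only receives. *)
Definition chan_ok (L : nat) (s : state) (x : seq nat) : Prop :=
  if s is inl (inr _) then exists2 u, x = rcons u L & L \notin u else L \notin x.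

Section OneSide.
Variables (X : transducer) (k : nat) (other : state).
Variable C : state -> state -> seq nat -> seq nat -> Prop.
Hypothesis X_valid : valid X.

Let L := tr_letters X.
Local Notation home := (chain_state X k).

Definition same_round (s t : state) (x y : seq nat) : Prop :=
  [/\ is_clean s -> is_clean t -> C s t x y, chan_ok L s x & chan_ok L t y].

(* Either both machines are in the same round, or one of them is already in the
   next round while its partner still has to receive the end marker. *)
Definition round_inv (s t : state) (x y : seq nat) : Prop :=
  [\/ same_round s t x y,
      exists f v y', [/\ s = Back f, x = [::], y = v ++ L :: y', L \notin v &
                         same_round home t [::] y'] |
      exists f v x', [/\ t = Back f, y = [::], x = v ++ L :: x', L \notin v &
                         same_round s other x' [::]]].

(** Markers are received in phase [Back] only. The first machine to read one finds its partner in
    phase [Back] too, with a marker still under way to it; when the partner reads that marker, both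
    are in the same round again. *)
Lemma round_inv_step s t x y s' x' y' : is_clean other -> C home other [::] [::] ->
  (forall c c1 x y c' x' y', C (inr c) (inr c1) x y ->
     hstep (Some true) X home (inr c) x y (inr c') x' y' -> C (inr c') (inr c1) x' y') ->
  s \in states (Some true) X k -> round_inv s t x y ->
  hstep (Some true) X home s x y s' x' y' -> round_inv s' t x' y'.
Proof.
move=> hother C0 Cstep hs hi hh.
have send_ok t1 b x1 y1 : same_round s t1 x1 y1 ->
    tr_step (Some true) X home s (true, b) = Some s' -> same_round s' t1 (rcons x1 b) y1.
  move=> [h1 h2 h3] e; split=> //.
    move=> cs' ct; case: s hs h1 h2 e {hi hh} => [[[sd rd]|f]|c] hs h1 h2 e.
    - by move: e cs'; rewrite /tr_step /=; case: ifP => [_ [<-]//|_]; case: ifP => // _ [<-].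
    - by move: e; rewrite /tr_step /= andbF.
    case: s' cs' e => // c' _ e; case: t1 ct h1 {h3} => // c1 _ /(_ isT isT) h1.
    exact: Cstep h1 (hstep_send _ _ e).
  case: s hs h1 h2 e {hi hh} => [[[sd rd]|f]|[[|a w] q]] hs h1 h2 e.
  - move: e; rewrite /tr_step /=; case: ifP => [hb [<-]|_].
      by rewrite /= mem_rcons inE negb_or h2 andbT /L; lia.
    by case: ifP => // /andP[/eqP -> _] [<-]; exists x1.
  - by move: e; rewrite /tr_step /= andbF.
  - by move: e; rewrite /tr_step.
  have [ha _] := clean_letter X_valid hs; rewrite -/L in ha.
  move: e; rewrite /tr_step /=; case: eqP => [-> [<-]|_].
    by rewrite /= mem_rcons inE negb_or h2 andbT; lia.
  case: ifP => // hb [<-]; by rewrite /= mem_rcons inE negb_or h2 andbT /L; lia.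
have back_recv f b s1 : tr_step (Some true) X home (Back f) (false, b) = Some s1 ->
    (b = L /\ s1 = home) \/ (b != L /\ exists f', s1 = Back f').
  rewrite /tr_step /=; case: andP => [[_ /eqP[->]] [<-]|_]; first by left.
  by case: ifP => // hb [<-]; right; split; [rewrite /L; lia|eexists].
have pop b y1 : chan_ok L t (b :: y1) -> b != L -> chan_ok L t y1.
  have np a z : L \notin a :: z -> L \notin z by rewrite inE negb_or => /andP[].
  case: t {hi send_ok} => [[?|?]|?] /=; try by move=> /np.
  move=> [[|a u] /= [-> ->]]; first by rewrite eqxx.
  by move=> /np h _; exists u.
inversion hh as [? ? b ? ? e|? ? b ? ? e]; subst.
  case: hi => [h|[f [v [y1 [es _ _ _ _]]]]|[f [v [x1 [et ey ex hv h]]]]].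
  - by apply: Or31; apply: send_ok.
  - by move: e; rewrite es /tr_step /= andbF.
  apply: Or33; exists f, v, (rcons x1 b); split=> //; last exact: send_ok.
  by rewrite ex rcons_cat.
case: hi => [[h1 h2 h3]|[f [v [y1 [es ex ey hv h]]]]|[f [v [x1 [_ //]]]]]; last first.
  rewrite es in e; case/back_recv: e => [[eb ->]|[nb [f' ->]]].
    apply: Or31; case: v ey hv => [|a v] /= [ea ->]; first by rewrite ex.
    by rewrite inE -ea eb eqxx.
  apply: Or32; case: v ey hv => [|a v] /= [ea ->]; first by rewrite ea eqxx in nb.
  by rewrite inE negb_or => /andP[_ hv]; exists f', v, y1.
case: s hs h1 h2 e {hh send_ok} => [[[sd rd]|f]|[[|a w] q]] hs h1 h2 e.
- by move: e; rewrite /tr_step.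
- case/back_recv: e => [[eb ->]|[nb [f' ->]]]; last first.
    by apply: Or31; split=> //; apply: pop h3 nb.
  case: h2 => u ex hu; case: t {pop} h1 h3 => [[?|f']|?] h1 /=.
  + by rewrite eb inE eqxx.
  + move=> [[|a u'] /= [ea ->]]; last by rewrite inE -ea eb eqxx.
    move=> _; apply: Or33; exists f', u, [::]; rewrite ex cats1; split=> //.
    by split=> //; case: (other) hother => [[|]|].
  + by rewrite eb inE eqxx.
- have hl := valid_letters X_valid.
  have nb : b != L.
    move: e; rewrite /tr_step /=; case: eqP => [-> _|_]; first by rewrite /L; lia.
    by case: ifP => // hb _; rewrite /L; lia.
  apply: Or31; split; last exact: pop h3 nb.
    case: s' e => // c' e _ ct; case: t ct h1 {pop h3} => // c1 _ /(_ isT isT) h1.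
    exact: Cstep h1 (hstep_recv _ _ e).
  move: e; rewrite /tr_step /=; case: eqP => [_ [<-] //|_].
  by case: ifP => // _ [<-].
by move: e; rewrite /tr_step.
Qed.

End OneSide.

(** With empty channels both machines are in the same round and none is in phase [Back], whose
    marker would still be in the channel. Stray machines send, so a deadlock would leave two clean
    machines with nothing pending, that is, an empty queue. *)
Lemma deadlock_free_send X k : valid X -> (forall q, ~ qreach X k q [::]) ->
  deadlock_free (tr_protocol (Some true) X (echo (tr_letters X)) k).
Proof.
move=> vX hq; have vE := echo_valid (valid_letters vX); set E := echo _ in vE *.
pose C := clean_inv X k; pose C' s1 s0 xb xa := C s0 s1 xa xb.
(* Exchanging the machines exchanges the last two alternatives, so the one-sided lemma serves
   both. *)
have swap s t x y : round_inv X k (chain_state E 0) C s t x y ->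
    round_inv E 0 (chain_state X k) C' t s y x.
  have sw s' t' x' y' : same_round X C s' t' x' y' -> same_round E C' t' s' y' x'.
    by move=> [h1 h2 h3]; split=> // h4 h5; apply: h1.
  case=> [/sw ?|[f [v [y' [-> -> -> hv /sw h]]]]|[f [v [y' [-> -> -> hv /sw h]]]]].
  - exact: Or31.
  - by apply: Or33; exists f, v, y'.
  - by apply: Or32; exists f, v, y'.
have swap' s t x y : round_inv E 0 (chain_state X k) C' t s y x ->
    round_inv X k (chain_state E 0) C s t x y.
  have sw s' t' x' y' : same_round E C' t' s' y' x' -> same_round X C s' t' x' y'.
    by move=> [h1 h2 h3]; split=> // h4 h5; apply: h1.
  case=> [/sw ?|[f [v [y' [-> -> -> hv /sw h]]]]|[f [v [y' [-> -> -> hv /sw h]]]]].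
  - exact: Or31.
  - by apply: Or33; exists f, v, y'.
  - by apply: Or32; exists f, v, y'.
have inv s0 s1 xa xb : areach (Some true) X E k s0 s1 xa xb ->
    round_inv X k (chain_state E 0) C s0 s1 xa xb.
  elim=> [|t0 t1 ya yb t0' ya' yb' hr IH hh|t0 t1 ya yb t1' ya' yb' hr IH hh].
  - by apply: Or31; split=> // _ _; apply: clean_inv_init.
  - have [m0 m1] := areach_states vX vE hr.
    apply: (round_inv_step vX _ _ _ m0 IH hh) => //; first exact: clean_inv_init.
    by move=> c c1 x y c' x' y'; apply: clean_inv_step0.
  have [m0 m1] := areach_states vX vE hr.
  apply: swap'; apply: (round_inv_step vE _ _ _ m1 (swap _ _ _ _ IH) hh) => //.
    exact: clean_inv_init.
  by move=> c c1 x y c' x' y'; apply: clean_inv_step1.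
apply/(deadlock_freeP _ _ vX vE) => s0 s1 /inv.
case=> [[h1 h2 h3]|[f [[|a v] [y [_ _]]]] //|[f [[|a v] [x [_ _]]]] //].
case: s0 h1 h2 => [[[sd rd]|f]|[w0 q0]] h1 //= => [[[|u v] //]|_].
case: s1 h1 h3 => [[[sd rd]|f]|[w1 q1]] h1 //= => [_|[[|u v] //]|_].
  by rewrite orbT.
case: w0 w1 h1 => [|? ?] [|? ?] // /(_ isT isT) /=.
by move=> /hq.
Qed.

(** * Bounded channels when stray machines receive first *)

Definition pending (s : state) : nat := if s is inr c then size c.1 else 0.
(** A letter on its way to a clean machine counts twice, as it may be answered by two letters; on
    its way to a stray machine it counts once. *)
Definition weight (s : state) : nat := (is_clean s).+1.

Section OneSideRecv.
Variables (X : transducer) (k N : nat).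
Variable C : state -> state -> seq nat -> seq nat -> Prop.
Hypothesis X_valid : valid X.

Let L := tr_letters X.
Local Notation home := (chain_state X k).

(* A clean machine sends at most two letters per received letter and a stray one
   sends nothing, so the weighted amount of data in transit cannot grow once a
   machine has strayed. *)
Definition recv_inv (s t : state) (x y : seq nat) : Prop :=
  [/\ L \notin x, L \notin y, (forall f, s <> Back f) /\ (forall f, t <> Back f),
      is_clean s -> is_clean t -> C s t x y
    & weight t * size x + weight s * size y + pending s + pending t <= 2 * N].

(** While both machines are clean the bound comes from [C]. Phase [Back] is entered by receiving a
    marker, and a marker is sent from there only, so neither ever occurs. *)
Lemma recv_inv_step s t x y s' x' y' :
  (forall s t x y, is_clean s -> is_clean t -> C s t x y ->
     size x + size y + pending s + pending t <= N) ->
  (forall c c1 x y c' x' y', C (inr c) (inr c1) x y ->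
     hstep (Some false) X home (inr c) x y (inr c') x' y' -> C (inr c') (inr c1) x' y') ->
  s \in states (Some false) X k -> recv_inv s t x y ->
  hstep (Some false) X home s x y s' x' y' -> recv_inv s' t x' y'.
Proof.
move=> CN Cstep hs [hx hy [ns nt] hC hw] hh.
have hl := valid_letters X_valid.
have hC' : is_clean s' -> is_clean s -> is_clean t -> C s' t x' y'.
  case: s hC hh {hs ns hw} => // c hC hh; case: s' hh => // c' hh _ _ ht.
  by case: t ht hC {nt} => // c1 _ /(_ isT isT) h1; apply: Cstep h1 hh.
have hcc : is_clean s -> is_clean t ->
    size x + size y + pending s + pending t <= N by move=> h1 h2; apply: CN => //; apply: hC.
case: hh hs hx hy ns hC hw hC' hcc => {s s' x y x' y'} [s s' b x y e|s s' b x y e];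
  move=> hs hx hy ns hC hw hC' hcc.
  case: s hs ns hC hw hC' hcc e => [[[sd rd]|f]|[[|a w] q]] hs ns hC hw hC' hcc e.
  - by move: e; rewrite /tr_step.
  - by have := ns f.
  - by move: e; rewrite /tr_step.
  have [ha _] := clean_letter X_valid hs; rewrite -/L in ha.
  move: e; rewrite /tr_step /=; case: eqP => [eb [es']|_].
    rewrite -es' in hC' *; split=> //.
    + by rewrite mem_rcons inE negb_or hx andbT eb; lia.
    + by move=> _ ct; apply: hC'.
    rewrite size_rcons; case ct: (is_clean t) hw hcc; rewrite /weight ct /=; last by lia.
    by move=> _ /(_ isT isT); lia.
  case: ifP => // hb [es']; rewrite -es' in hC' *; split=> //.
  - by rewrite mem_rcons inE negb_or hx andbT /L; lia.
  rewrite size_rcons; case ct: (is_clean t) hw hcc; rewrite /weight ct /=; last by lia.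
  by move=> _ /(_ isT isT); lia.
move: hy; rewrite inE negb_or => /andP[/eqP nb hy].
case: s hs ns hC hw hC' hcc e => [[[sd rd]|f]|[[|a w] q]] hs ns hC hw hC' hcc e.
- move: e; rewrite /tr_step /=; case: ifP => [hb [es']|_].
    rewrite -es' in hC' *; split=> //.
    by move: hw; rewrite /weight /=; lia.
  by case: ifP => // /andP[/eqP]; rewrite -/L => ?; case: nb.
- by have := ns f.
- move: e; rewrite /tr_step /=; case: eqP => [eb [es']|/eqP b1].
    by rewrite -es' in hC' *; split=> //; move: hw; rewrite /weight /=; lia.
  case: ifP => // hb [es']; rewrite -es' in hC' *.
  have [hc|[i //]] := states_clean X_valid hs.
  have [[_ _ hq] _] := clean_reach_valid X_valid hc.
  have gb : good X b by apply/andP.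
  have [h2 _ _ _] := valid_next X_valid hq gb.
  split=> //; first by move=> _ ct; apply: hC'.
  case ct: (is_clean t) hw hC'; last by rewrite /weight ct /=; lia.
  move=> _ /(_ isT isT isT) /CN; rewrite ct => /(_ isT isT).
  by rewrite /weight ct /=; lia.
by move: e; rewrite /tr_step.
Qed.

End OneSideRecv.

Lemma bounded_recv X k N : valid X -> (forall q u, qreach X k q u -> size u <= N) ->
  bounded_channel (tr_protocol (Some false) X (echo (tr_letters X)) k).
Proof.
move=> vX hq; have vE := echo_valid (valid_letters vX); set E := echo _ in vE *.
pose C := clean_inv X k; pose C' s1 s0 xb xa := C s0 s1 xa xb.
have CN s t x y : is_clean s -> is_clean t -> C s t x y ->
    size x + size y + pending s + pending t <= N.
  case: s t => [//|[w0 q0]] [//|[w1 q1]] _ _ /hq.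
  by rewrite !size_cat /=; lia.
have inv s0 s1 xa xb : areach (Some false) X E k s0 s1 xa xb ->
    recv_inv X N C s0 s1 xa xb.
  elim=> [|t0 t1 ya yb t0' ya' yb' hr IH hh|t0 t1 ya yb t1' ya' yb' hr IH hh].
  - split=> //; first by move=> _ _; apply: clean_inv_init.
    have := CN (chain_state X k) (chain_state E 0) [::] [::] isT isT (clean_inv_init _ _).
    by rewrite /=; lia.
  - have [m0 m1] := areach_states vX vE hr.
    apply: (recv_inv_step vX CN _ m0 IH hh).
    by move=> c c1 x y c' x' y'; apply: clean_inv_step0.
  have [m0 m1] := areach_states vX vE hr.
  have IH' : recv_inv E N C' t1 t0 yb ya.
    case: IH => h1 h2 [h3 h4] h5 h6; split=> //; last by lia.
    by move=> h7 h8; apply: h5.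
  have := recv_inv_step vE _ _ m1 IH' hh; case.
  - by move=> s t x y hs ht /(CN _ _ _ _ ht hs); lia.
  - by move=> c c1 x y c' x' y'; apply: clean_inv_step1.
  move=> h1 h2 [h3 h4] h5 h6; split=> //; last by lia.
  by move=> h7 h8; apply: h5.
apply/(bounded_channelP _ _ vX vE); exists (2 * N) => s0 s1 xa xb /inv[_ _ _ _].
by rewrite /weight; case: is_clean; case: is_clean => /=; lia.
Qed.

(** * Simulating a register machine by a queue transducer *)

Definition instr_reg (i : instr) : nat :=
  match i with INC r _ => r | DEC r _ _ => r end.

Definition reg_bound (B : program) : nat := (foldr maxn 0 (map instr_reg B)).+1.

Lemma reg_bound_lt B i : i < size B -> instr_reg (nth (INC 0 0) B i) < reg_bound B.
Proof.
rewrite /reg_bound ltnS; elim: B i => // a B IH [_|i] /=; first exact: leq_maxl.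
by rewrite ltnS => /IH h; apply: leq_trans h (leq_maxr _ _).
Qed.

(** The successor keeps instruction 0 off the initial control state 0, which stands for the same
    instruction; [minn] merges all addresses outside the program. *)
Definition at_main (B : program) (pc : nat) : nat := (minn pc (size B)).+1.*2.

(* Register [r] with value [v] is held as [v] copies of the letter [2r] in the
   queue; the letter [3] marks the end of a pass.  Even control states wait for
   the mark in order to execute instruction [q./2.-1] (or swallow the queue if
   there is no such instruction), odd ones look for a letter to remove. *)
Definition qa_next (B : program) (q l : nat) : seq nat * nat :=
  let pc := (q./2).-1 in
  if odd q then
    match nth (INC 0 0) B pc with
    | DEC r j k => if l == r.*2 then ([::], at_main B j)
                   else if l == 3 then ([:: 3], at_main B k) else ([:: l], q)
    | INC _ _ => ([:: l], q)
    end
  else if pc < size B then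
    if l == 3 then
      match nth (INC 0 0) B pc with
      | INC r j => ([:: 3; r.*2], at_main B j)
      | DEC r j k => ([:: 3], (at_main B pc).+1)
      end
    else ([:: l], at_main B pc)
  else ([::], at_main B pc).

Definition qa (B : program) : transducer :=
  Transducer (qa_next B) 0 [:: 3] ((size B).*2 + 4) ((reg_bound B).*2 + 4).

Lemma qa_valid B : 0 < size B -> valid (qa B).
Proof.
move=> hB; split=> //=.
- by lia.
- by rewrite /good /= andbT; lia.
- by lia.
- by rewrite /qa_next /= hB.
move=> q l hq hl.
have g3 : good (qa B) 3 by rewrite /good /=; lia.
have hm j : at_main B j < (size B).*2 + 4 by rewrite /at_main; lia.
rewrite /qa_next; case ho: (odd q).
  case: nth => [r j|r j k]; last case: ifP => _; last case: ifP => _;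
    rewrite /= ?hl ?g3 ?hm //; split=> //; by case: (q) ho.
case: ifP => hpc; last by rewrite hm.
case: ifP => _; last by rewrite /= hl hm.
have := reg_bound_lt hpc; case: nth => [r j|r j k] /= hr.
  have gr : good (qa B) r.*2 by rewrite /good /=; lia.
  by rewrite g3 gr hm.
by rewrite g3; split=> //; rewrite /at_main; lia.
Qed.

(** * Correctness of the simulation *)

Section Simulation.
Variables (B : program) (k : nat).

Let R := reg_bound B.
Local Notation I := (nth (INC 0 0) B).
Local Notation reach := (qreach (qa B) k).

(** Only the numbers of occurrences matter, so rotating the queue is harmless. *)
Definition encodes (f : regs) (u : seq nat) : Prop :=
  [/\ count_mem 3 u = 1, forall r, count_mem r.*2 u = f r
    & all (fun l => (l == 3) || ~~ odd l && (l < R.*2)) u].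

Lemma encodes_rot f u v : encodes f (u ++ v) -> encodes f (v ++ u).
Proof.
move=> [h1 h2 h3]; split; [|move=> r; move: (h2 r)|]; move: h1 h3.
- by rewrite !count_cat; lia.
- by rewrite !count_cat; lia.
by rewrite !all_cat andbC.
Qed.

Lemma encodes_size f u : encodes f u -> size u = (reg_total R f).+1.
Proof.
move=> [h1 h2 h3].
suff <- : count_mem 3 u + \sum_(r < R) count_mem (r : nat).*2 u = size u.
  by rewrite h1 add1n; congr _.+1; apply: eq_bigr => r _; rewrite h2.
elim: u h3 {h1 h2} => [|l u IH] /=; first by rewrite big1.
case/andP=> hl /IH <-; rewrite big_split /=.
case/orP: hl => [/eqP ->|/andP[ho hl]].
  by rewrite eqxx big1 => [|i _]; [lia|case: eqP => //; lia].
have hr : l./2 < R by lia.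
rewrite (bigD1 (Ordinal hr)) //= big1 => [|i /eqP ne].
  by case: eqP => [->//|_]; rewrite even_halfK // eqxx; lia.
by case: eqP => // e; case: ne; apply: val_inj => /=; lia.
Qed.

Lemma encodes_input : encodes (input k) (nseq k 0 ++ [:: 3]).
Proof.
split.
- by rewrite count_cat count_nseq /=; lia.
- move=> r; rewrite count_cat count_nseq /= /input /upd; case: r => [|r] /=; lia.
by rewrite all_cat all_nseq /= /R /reg_bound; lia.
Qed.

Lemma encodes_inc f u r : r < R -> encodes f (3 :: u) ->
  encodes (upd f r (f r).+1) (u ++ [:: 3; r.*2]).
Proof.
move=> hr [h1 h2 h3]; split.
- by move: h1; rewrite count_cat /=; lia.
- move=> r'; move: (h2 r'); rewrite count_cat /= /upd; case: (eqVneq r' r) => [->|ne].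
    by rewrite eqxx; lia.
  have -> : (r.*2 == r'.*2) = false by apply/negP => /eqP ?; case/eqP: ne; lia.
  by lia.
by move: h3; rewrite all_cat /= => ->; lia.
Qed.

Lemma encodes_dec f u r : encodes f (r.*2 :: u) ->
  f r != 0 /\ encodes (upd f r (f r).-1) u.
Proof.
move=> [h1 h2 h3]; split; first by have := h2 r; rewrite /= eqxx; lia.
split.
- by move: h1 => /=; lia.
- move=> r'; move: (h2 r'); rewrite /= /upd; case: (eqVneq r' r) => [->|ne].
    by rewrite eqxx; lia.
  have -> : (r.*2 == r'.*2) = false by apply/negP => /eqP ?; case/eqP: ne; lia.
  by lia.
by case/andP: h3.
Qed.

Lemma encodes_zero f u r : encodes f u -> (f r == 0) = (r.*2 \notin u).
Proof. by move=> [_ h _]; rewrite -h -has_pred1 has_count lt0n negbK. Qed.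

Lemma conf_step t pc f : conf B k t = (pc, f) ->
  conf B k t.+1 = if rm_step B (pc, f) is Some c then c else (pc, f).
Proof. by move=> e; rewrite /conf rm_runSr -/(conf B k t) e. Qed.

Lemma at_mainE pc : odd (at_main B pc) = false /\ (at_main B pc)./2.-1 = minn pc (size B).
Proof. by rewrite /at_main; split; lia. Qed.

(** In an odd state the part [u2] behind the mark has already been searched in vain for [r.*2]. Once
    the program has halted the queue is being swallowed and encodes nothing. *)
Definition simulates (q : nat) (u : seq nat) (t : nat) : Prop :=
  let: (pc, f) := conf B k t in
  if odd q then
    exists r j k' u1 u2, [/\ pc < size B, q./2.-1 = pc, I pc = DEC r j k',
      u = u1 ++ 3 :: u2 & r.*2 \notin u2] /\ encodes f u
  else q./2.-1 = minn pc (size B) /\ (pc < size B -> encodes f u).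

Lemma simulates_main pc f t u : conf B k t = (pc, f) -> encodes f u ->
  simulates (at_main B pc) u t.
Proof. by move=> e h; rewrite /simulates e; have [-> ->] := at_mainE pc. Qed.

Lemma reach_simulates q u : reach q u -> exists t, simulates q u t.
Proof.
elim=> [|{}q b {}u _ [t]].
  by exists 0; rewrite /simulates /conf /= min0n; split=> // _; apply: encodes_input.
rewrite {1}/simulates; case ec: (conf B k t) => [pc f]; rewrite /= /qa_next.
case ho: (odd q).
  move=> [r [j [k' [u1 [u2 [[hpc epc eI eu nr] henc]]]]]]; rewrite epc eI.
  have hs : rm_step B (pc, f) =
      if f r == 0 then Some (k', f) else Some (j, upd f r (f r).-1).
    by rewrite /= hpc eI.
  case: eqP => [eb|/eqP nb].
    rewrite eb in henc; have [nz henc'] := encodes_dec henc.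
    exists t.+1; rewrite cats0; apply: simulates_main henc'.
    by rewrite (conf_step ec) hs (negbTE nz).
  case: eqP => [eb|/eqP n3].
    (* There is only one mark; when it is in front, the whole rest has been searched and the
       register is zero. *)
    have [e2 e1] : u = u2 /\ u1 = [::].
      case: u1 eu => [[_ ->] //|a u1 [ea eu]].
      by case: henc => + _ _; rewrite eb eu /= count_cat /=; lia.
    have z : f r == 0.
      by rewrite (encodes_zero _ henc) inE negb_or e2 nr andbT eb; lia.
    exists t.+1; apply: (@simulates_main k' f).
      by rewrite (conf_step ec) hs z.
    by rewrite -eb; apply: (@encodes_rot _ [:: b]).
  exists t; rewrite /simulates ec ho.
  case: u1 eu => [[eb _]|a u1 [ea eu]]; first by rewrite eb in n3.
  exists r, j, k', u1, (u2 ++ [:: b]); split; last exact: (@encodes_rot _ [:: b]).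
  split=> //; first by rewrite eu -catA.
  by rewrite mem_cat inE negb_or nr eq_sym.
move=> [-> henc]; case: ltnP => hpc; last first.
  exists t; rewrite /simulates ec.
  have [-> ->] := at_mainE (minn pc (size B)); split; lia.
have epc : minn pc (size B) = pc by lia.
have {hpc} hpc : pc < size B by lia.
rewrite epc; have {}henc := henc hpc.
case: eqP => [eb|_]; last first.
  exists t; apply: (simulates_main ec); exact: (@encodes_rot _ [:: b]).
rewrite eb in henc; have := reg_bound_lt hpc.
case eI: (I pc) => [r j|r j k'] /= hr.
  exists t.+1; apply: (@simulates_main j (upd f r (f r).+1)).
    by rewrite (conf_step ec) /= hpc eI.
  exact: encodes_inc.
exists t; rewrite /simulates ec /at_main ifT; last lia.
exists r, j, k', u, [::]; split; last exact: (@encodes_rot _ [:: 3]).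
by split=> //; lia.
Qed.

Lemma reach_nonempty q u : ~ halts B k -> reach q u ->
  exists t, encodes (conf B k t).2 u.
Proof.
move=> nh /reach_simulates[t]; rewrite /simulates => h; exists t.
case ec: (conf B k t) h => [pc f]; case: (odd q) => [[? [? [? [? [? []]]]]] //|[_]].
apply; case: ltnP => // hpc; case: nh; exists t.
by rewrite ec /= ltnNge hpc.
Qed.

(** The control state may pass from the initial 0 to [at_main B pc], hence the new [q']. *)
Lemma reach_rot_main pc q v w : odd q = false -> q./2.-1 = pc -> pc < size B ->
  3 \notin v -> reach q (v ++ w) ->
  exists q', [/\ odd q' = false, q'./2.-1 = pc & reach q' (w ++ v)].
Proof.
move=> + + hpc; elim: v q w => [|l v IH] q w ho eq.
  by move=> _ h; exists q; rewrite cats0.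
rewrite inE negb_or eq_sym => /andP[/negbTE l3 hv] /= h.
have h1 := qreach_step h; rewrite /= /qa_next ho eq hpc l3 /= -catA in h1.
have [e1 e2] := at_mainE pc.
have e2' : (at_main B pc)./2.-1 = pc by rewrite e2; lia.
have [q' [h2 h3 h4]] := IH _ _ e1 e2' hv h1.
by exists q'; rewrite -cat_rcons -cats1.
Qed.

Lemma reach_rot_dec r j k' q v w : odd q -> I q./2.-1 = DEC r j k' ->
  3 \notin v -> r.*2 \notin v -> reach q (v ++ w) -> reach q (w ++ v).
Proof.
move=> ho eI; elim: v w => [|l v IH] w; first by rewrite cats0.
rewrite !inE !negb_or ![_ == l]eq_sym => /andP[/negbTE l3 hv] /andP[/negbTE lr hv'] /= h.
have h1 := qreach_step h; rewrite /= /qa_next ho eI l3 lr /= -catA in h1.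
by have := IH _ hv hv' h1; rewrite -catA.
Qed.

(** The converse of [reach_simulates]: rotate until the mark is in front and execute the
    instruction; for a [DEC], rotate on to the first letter [r.*2], or to the mark if there is
    none. *)
Lemma simulates_reach t : exists q u, [/\ reach q u, odd q = false,
  q./2.-1 = minn (conf B k t).1 (size B) & encodes (conf B k t).2 u].
Proof.
elim: t => [|t [q [u [hr ho eq henc]]]].
  exists 0, (nseq k 0 ++ [:: 3]); split=> //; first exact: (qreach_init (qa B) k).
    by rewrite /= min0n.
  exact: encodes_input.
case ec: (conf B k t) eq henc => [pc f] /= eq henc; rewrite (conf_step ec) /=.
case: ltnP => hpc; last by exists q, u; rewrite eq; split=> //=; lia.
have epc : minn pc (size B) = pc by lia.
have [v [w [eu nv]]] : exists v w, u = v ++ 3 :: w /\ 3 \notin v.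
  have h3 : 3 \in u by case: henc => h _ _; rewrite -has_pred1 has_count h.
  exists (take (index 3 u) u), (drop (index 3 u).+1 u); split.
    by rewrite -{2}(nth_index 0 h3) -drop_nth ?index_mem // cat_take_drop.
  by rewrite in_take_leq ?index_size // ltnn.
have [||q1 [ho1 eq1 hr1]] := @reach_rot_main pc q v (3 :: w) ho _ hpc nv.
- by rewrite eq epc.
- by rewrite -eu.
have henc1 : encodes f (3 :: (w ++ v)) by apply: (@encodes_rot f v (3 :: w)); rewrite -eu.
have {}hr1 : reach q1 (3 :: (w ++ v)) := hr1.
move: (w ++ v) henc1 hr1 => z henc1 hr1.
have hr2 := qreach_step hr1; rewrite /= /qa_next ho1 eq1 hpc /= in hr2.
have := reg_bound_lt hpc; case eI: (I pc) hr2 => [r j|r j k'] /= hr2 hreg.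
  have [e1 e2] := at_mainE j.
  by do 2 eexists; split; [exact: hr2| | |apply: encodes_inc].
set qd := (at_main B pc).+1 in hr2.
have hqd : odd qd by rewrite /qd /at_main; lia.
have eqd : I qd./2.-1 = DEC r j k'.
  have -> : qd./2.-1 = pc by rewrite /qd /at_main; lia.
  exact: eI.
have n3 : 3 \notin z.
  by apply/count_memPn; case: henc1 => /= h _ _; lia.
case: ifP => hz.
  have nz : r.*2 \notin z.
    by move: hz; rewrite (encodes_zero _ henc1) inE negb_or => /andP[].
  have h := reach_rot_dec hqd eqd n3 nz hr2.
  have h1 := qreach_step h; rewrite /= /qa_next hqd eqd /= in h1.
  have e3 : (3 == r.*2) = false by lia.
  rewrite e3 /= in h1; have [e1 e2] := at_mainE k'.
  by do 2 eexists; split; [exact: h1| | |apply: (@encodes_rot f [:: 3])].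
have rz : r.*2 \in z.
  by move: hz; rewrite (encodes_zero _ henc1) inE negb_or => /negbT;
     rewrite negb_and !negbK => /orP[/eqP|//]; lia.
have [v1 [v2 [ez nv1]]] : exists v1 v2, z = v1 ++ r.*2 :: v2 /\ r.*2 \notin v1.
  exists (take (index r.*2 z) z), (drop (index r.*2 z).+1 z); split.
    by rewrite -{2}(nth_index 0 rz) -drop_nth ?index_mem // cat_take_drop.
  by rewrite in_take_leq ?index_size // ltnn.
have n31 : 3 \notin v1 by move: n3; rewrite ez mem_cat negb_or => /andP[].
rewrite ez -catA in hr2; have h := reach_rot_dec hqd eqd n31 nv1 hr2.
have h1 := qreach_step h; rewrite /= /qa_next hqd eqd /= eqxx /= in h1.
have henc2 : encodes f (r.*2 :: ((v2 ++ [:: 3]) ++ v1)).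
  apply: (@encodes_rot f v1 (r.*2 :: (v2 ++ [:: 3]))).
  rewrite -cat_cons catA -ez.
  exact: (@encodes_rot f [:: 3]).
have [_ henc3] := encodes_dec henc2; have [e1 e2] := at_mainE j.
by do 2 eexists; split; [exact: h1| | |rewrite cats0].
Qed.

Lemma reach_empty : halts B k -> exists q, reach q [::].
Proof.
move=> [t]; have [q [u [hr ho eq _]]] := simulates_reach t.
case: (conf B k t) eq => pc f /= eq; case: ltnP => [hpc|hpc _].
  by case: nth => // r j k'; case: ifP.
have {}eq : q./2.-1 = size B by rewrite eq; lia.
elim: u q ho eq hr => [|b u IH] q ho eq hr; first by exists q.
have := qreach_step hr; rewrite /= /qa_next ho eq ltnn /= cats0 => h.
by have [e1 e2] := at_mainE (size B); apply: IH h => //; rewrite e2 minnn.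
Qed.

Lemma reach_bounded N : ~ halts B k -> (forall t, reg_total R (conf B k t).2 <= N) ->
  forall q u, reach q u -> size u <= N.+1.
Proof. by move=> nh hN q u /(reach_nonempty nh)[t /encodes_size ->]; rewrite ltnS; apply: hN. Qed.

Lemma reach_unbounded : (forall N, exists t, N <= (conf B k t).2 0) ->
  forall N, exists q u, reach q u /\ N <= size u.
Proof.
move=> h N; have [t ht] := h N; have [q [u [hr _ _ [_ hc _]]]] := simulates_reach t.
by exists q, u; split=> //; apply: leq_trans ht _; rewrite -hc; apply: count_size.
Qed.

End Simulation.

(** * Undecidability *)

Definition sim_protocol (md : mode) (B : program) (k : nat) : protocol :=
  tr_protocol md (qa B) (echo (tr_letters (qa B))) k.

Lemma sim_echo_valid B : valid (echo (tr_letters (qa B))).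
Proof. by apply: echo_valid => /=; lia. Qed.

(** The parameters do not depend on the chain length, so their own code can be chosen as this
    length. *)
Lemma self_input md B : exists k, pickle (sim_protocol md B k) = self_code k.
Proof. eexists (params _ _ _ _ _ _); rewrite self_code_params; exact: pickle_tr_protocol. Qed.

Lemma sim_deadlock_free md B k : 0 < size B -> md <> Some false ->
  deadlock_free (sim_protocol md B k) <-> ~ halts B k.
Proof.
move=> hB hmd; have vB := qa_valid hB; split=> [hdf /reach_empty[q hq]|nh].
  by apply: (qreach_deadlock vB _ hq) hdf; exact: valid_letters.
have h q : ~ qreach (qa B) k q [::].
  by move=> /(reach_nonempty nh)[t [] /=].
by case: md hmd => [[] //|] _; [apply: deadlock_free_send|apply: deadlock_free_none].
Qed.

Lemma sim_bounded md B k N : 0 < size B -> md <> Some true -> ~ halts B k ->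
  (forall R t, reg_total R (conf B k t).2 <= N) ->
  bounded_channel (sim_protocol md B k).
Proof.
move=> hB hmd nh hN; have vB := qa_valid hB.
have h := reach_bounded nh (hN (reg_bound B)).
by case: md hmd => [[] //|] _; [apply: bounded_recv h|apply: bounded_none h].
Qed.

Lemma sim_unbounded md B k : 0 < size B -> (forall N, exists t, N <= (conf B k t).2 0) ->
  ~ bounded_channel (sim_protocol md B k).
Proof.
move=> hB h; have vB := qa_valid hB.
by apply: (qreach_unbounded vB (valid_letters vB)) (reach_unbounded h).
Qed.

(** On the self-referential [k], [B] halts iff the decider answers 1, iff the protocol is
    deadlock-free, iff [B] does not halt. *)
Lemma undecidable_deadlock (md : mode) (D : protocol -> Prop) : md <> Some false ->
  (forall B k, 0 < size B -> D (sim_protocol md B k)) -> undecidable D deadlock_free.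
Proof.
move=> hmd hD [A hA]; have [B hB h] := diagonal_halting A.
have [k ek] := self_input md B.
have [m [hm hQ]] := hA _ (hD B k hB); rewrite ek in hm.
have hh := h _ _ hm; have hd := sim_deadlock_free k hB hmd.
have nh : ~ halts B k by move=> hx; move: (hx) => /hh /hQ /hd.
by apply: (nh); apply/hh/hQ/hd.
Qed.

(** Answer 1 makes register 0, and with it the queue, grow forever; any other answer keeps the
    channels bounded. Either way the decider is wrong. *)
Lemma undecidable_bounded (md : mode) (D : protocol -> Prop) : md <> Some true ->
  (forall B k, 0 < size B -> ~ halts B k -> D (sim_protocol md B k)) ->
  undecidable D bounded_channel.
Proof.
move=> hmd hD [A hA]; have [B [hB nh] h] := diagonal_growth A.
have [k ek] := self_input md B.
have [m [hm hQ]] := hA _ (hD B k hB (nh k)); rewrite ek in hm.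
have [h1 h2] := h _ _ hm; case: (eqVneq m 1) => [m1|/eqP m1].
  by apply: (sim_unbounded (md := md) hB (h1 m1)); apply/hQ.
have [N hN] := h2 m1; apply/m1/hQ.
exact: sim_bounded (nh k) hN.
Qed.

Theorem theorem7p1 :
  [/\ (* (a) *)
      undecidable (fun P : protocol => SR_pair P /\ no_send_cycles P)
                  deadlock_free,
      (* (b) *)
      undecidable (fun P : protocol =>
                     [/\ SR_pair P, deadlock_free P & no_send_cycles P])
                  bounded_channel,
      (* (c) *)
      undecidable (fun P : protocol => SR_pair P /\ affine P)
                  deadlock_free
    & (* (d) *)
      undecidable (fun P : protocol => SR_pair P /\ affine P)
                  bounded_channel].
Proof.
have SR md B k : 0 < size B -> SR_pair (sim_protocol md B k).
  by move=> hB; apply: tr_protocol_SR => //; [apply: qa_valid|apply: sim_echo_valid].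
have nsc B k : 0 < size B -> no_send_cycles (sim_protocol None B k).
  by move=> hB; apply: tr_protocol_no_send_cycles; [apply: qa_valid|apply: sim_echo_valid].
have aff m B k : 0 < size B -> affine (sim_protocol (Some m) B k).
  by move=> hB; apply: tr_protocol_affine => //; [apply: qa_valid|apply: sim_echo_valid].
split.
- by apply: (@undecidable_deadlock None) => // B k hB; split; [apply: SR|apply: nsc].
- apply: (@undecidable_bounded None) => // B k hB nh; split; [exact: SR| |exact: nsc].
  (* The promise of deadlock freedom holds because [B] never halts. *)
  exact/sim_deadlock_free.
- by apply: (@undecidable_deadlock (Some true)) => // B k hB; split; [apply: SR|apply: aff].
by apply: (@undecidable_bounded (Some false)) => // B k hB _; split; [apply: SR|apply: aff].
Qed.
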